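(* Let the free group $F_A$ have a semi-saturated partial action $\theta$ on a second countable compact Hausdorff and totally disconnected space $X$. Then, for any field $K$, the algebra $K[F_A\ltimes X]\cong KX\rtimes F_A$ has global dimension at most $2$.
   Context: Partial actions: a partial action $\theta$ of a group $G$ on a locally compact Hausdorff totally disconnected space $X$ consists of, for each $g\in G$, a clopen subset $X_g\subseteq X$ and a homeomorphism $\theta_g\colon X_{g^{-1}}\to X_g$ such that $X_1=X$, $\theta_1=\mathrm{id}_X$, $\theta_g^{-1}=\theta_{g^{-1}}$, and whenever $\theta_g(\theta_h(x))$ is defined, $\theta_{gh}(x)$ is defined and equals it. $F_A$ is the free group on the set $A$ and $|w|$ is the length of the reduced word for $w\in F_A$. A partial action of $F_A$ is semi-saturated if $\theta_{uv}=\theta_u\circ\theta_v$ (equality of partial maps, including domains) whenever $|uv|=|u|+|v|$. Groupoid: $G\ltimes X$ has object space $X$ and arrow space $\{(g,x)\mid x\in X_{g^{-1}}\}\subseteq G\times X$ (subspace topology of the product topology, $G$ discrete), with $s(g,x)=x$, $r(g,x)=\theta_g(x)$, $(g,\theta_h(x))(h,x)=(gh,x)$, $(g,x)^{-1}=(g^{-1},\theta_g(x))$. Algebras: for a locally compact Hausdorff totally disconnected space $Y$, $KY$ is the $K$-module of compactly supported locally constant functions $Y\to K$. For a Hausdorff ample groupoid $\mathcal G$, $K\mathcal G$ is a $K$-algebra under convolution $(f\ast g)(\gamma)=\sum_{r(\alpha)=r(\gamma)}f(\alpha)g(\alpha^{-1}\gamma)$. For $X$ compact, the partial skew group ring $KX\rtimes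 G$ is $\bigoplus_{g\in G}KX_g\delta_g$ with multiplication $(f\delta_g)(f'\delta_h)=\alpha_g(\alpha_{g^{-1}}(f)f')\delta_{gh}$, where $KX_g\subseteq KX$ via extension by $0$, products of functions are pointwise, and $\alpha_g\colon KX_{g^{-1}}\to KX_g$ is $\alpha_g(f)=f\circ\theta_{g^{-1}}$. The (left) global dimension of a ring is the supremum of the projective dimensions of its left modules. *)

(* Defs.v *)
From HB Require Import structures.
From mathcomp Require Import all_boot all_order all_algebra.
From mathcomp Require Import all_classical all_reals all_analysis.

Set Implicit Arguments.
Unset Strict Implicit.
Unset Printing Implicit Defensive.

Import GRing.Theory.

Local Open Scope classical_set_scope.
Local Open Scope ring_scope.

Section FreeGroup.
Variable A : choiceType.

(* [(a, true)] stands for the generator [a], [(a, false)] for its inverse. *)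
Definition letter : Type := (A * bool)%type.
HB.instance Definition _ := Choice.on letter.

Definition linv (l : letter) : letter := (l.1, ~~ l.2).

Definition reduced (w : seq letter) : bool :=
  sorted (fun l l' => l' != linv l) w.

Record free_group := FreeGroup {
  fg_word : seq letter;
  fg_reduced : reduced fg_word }.

HB.instance Definition _ := [isSub for fg_word].
HB.instance Definition _ := [Choice of free_group by <:].

Definition fg_push (l : letter) (w : seq letter) : seq letter :=
  if w is l' :: w' then (if l' == linv l then w' else l :: w) else [:: l].

Definition word_mul (u v : seq letter) : seq letter := foldr fg_push v u.
Definition word_inv (u : seq letter) : seq letter := rev (map linv u).

Lemma linvK : involutive linv.
Proof. by case=> a b; rewrite /linv /= negbK. Qed.

Lemma fg_push_reduced l w : reduced w -> reduced (fg_push l w).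
Proof.
case: w => [|l' w] //=; case: ifP => [_|/negbT nl] /=; last by rewrite nl.
exact: path_sorted.
Qed.

Lemma fg_pushK l w : reduced w -> fg_push l (fg_push (linv l) w) = w.
Proof.
case: w => [|l' w] /=; first by rewrite eqxx.
rewrite linvK; case: (eqVneq l' l) => [-> | _]; last by rewrite /= eqxx.
by case: w => [|l'' w] //= /andP[/negbTE ->].
Qed.

Lemma fg_pushVK l w : reduced w -> fg_push (linv l) (fg_push l w) = w.
Proof. by rewrite -{2}[l]linvK; apply: fg_pushK. Qed.

Lemma word_mul_reduced u v : reduced v -> reduced (word_mul u v).
Proof. by move=> rv; elim: u => //= l u; apply: fg_push_reduced. Qed.

Lemma word_inv_reduced u : reduced u -> reduced (word_inv u).
Proof.
rewrite /reduced /word_inv rev_sorted sorted_map.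
apply: sub_sorted => l l' /=; apply: contraNN => /eqP e.
by rewrite linvK in e; rewrite -e.
Qed.

Lemma word_mul_push l v w : reduced v -> reduced w ->
  word_mul (fg_push l v) w = fg_push l (word_mul v w).
Proof.
case: v => [|l' v] //= rv rw; case: eqP => [->|_] //=.
by rewrite fg_pushK // word_mul_reduced.
Qed.

Lemma word_mulA u v w : reduced v -> reduced w ->
  word_mul u (word_mul v w) = word_mul (word_mul u v) w.
Proof.
move=> rv rw; elim: u => //= l u ->.
by rewrite word_mul_push // word_mul_reduced.
Qed.

Lemma word_mul1 u : reduced u -> word_mul u [::] = u.
Proof.
elim: u => //= l u IHu ru; rewrite IHu; last exact: path_sorted ru.
by case: u ru {IHu} => //= l' u /andP[/negbTE ->].
Qed.

Lemma word_mulV u : reduced u -> word_mul (word_inv u) u = [::].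
Proof.
elim: u => //= l u IHu ru.
rewrite /word_inv /= rev_cons -cats1 /word_mul foldr_cat /= linvK eqxx.
by apply: IHu; apply: path_sorted ru.
Qed.

Lemma word_invK : involutive word_inv.
Proof.
by move=> u; rewrite /word_inv map_rev revK -map_comp map_id_in // => l _; apply: linvK.
Qed.

Definition fg_mul (u v : free_group) : free_group :=
  FreeGroup (word_mul_reduced (fg_word u) (fg_reduced v)).
Definition fg_inv (u : free_group) : free_group :=
  FreeGroup (word_inv_reduced (fg_reduced u)).
Definition fg_one : free_group := @FreeGroup [::] isT.

Lemma fg_mulA : associative fg_mul.
Proof. by move=> u v w; apply/val_inj/word_mulA; exact: fg_reduced. Qed.
Lemma fg_mul1 : left_id fg_one fg_mul.
Proof. by move=> u; apply: val_inj. Qed.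
Lemma fg_mulr1 : right_id fg_one fg_mul.
Proof. by move=> u; apply/val_inj/word_mul1/fg_reduced. Qed.
Lemma fg_mulV : left_inverse fg_one fg_inv fg_mul.
Proof. by move=> u; apply/val_inj/word_mulV/fg_reduced. Qed.
Lemma fg_mulrV : right_inverse fg_one fg_inv fg_mul.
Proof.
move=> u; apply: val_inj => /=; rewrite -[X in word_mul X _]word_invK.
by apply: word_mulV; apply/word_inv_reduced/fg_reduced.
Qed.

HB.instance Definition _ :=
  isGroup.Build free_group fg_mulA fg_mul1 fg_mulr1 fg_mulV fg_mulrV.

Definition fg_length (u : free_group) : nat := size (fg_word u).

End FreeGroup.

(* [pdom g] is the domain X_g of theta_{g^-1}. The homeomorphism
   theta_g : X_{g^-1} -> X_g is encoded by the total function [pact g], whose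
   values outside X_{g^-1} are irrelevant; the continuity of its inverse is that
   of [pact g^-1]. *)
Record partial_action (G : groupType) (X : topologicalType) := PartialAction {
  pdom : G -> set X;
  pact : G -> X -> X;
  pdom_clopen : forall g, clopen (pdom g);
  pact_bij : forall g, set_bij (pdom g^-1%g) (pdom g) (pact g);
  pact_continuous : forall g, {within pdom g^-1%g, continuous (pact g)};
  pdom1 : pdom 1%g = [set: X];
  pact1 : forall x, pact 1%g x = x;
  pactV : forall g x, pdom g^-1%g x -> pact g^-1%g (pact g x) = x;
  pactM : forall g h x, pdom h^-1%g x -> pdom g^-1%g (pact h x) ->
    pdom (g * h)^-1%g x /\ pact (g * h)%g x = pact g (pact h x) }.

Definition semi_saturated (A : choiceType) (X : topologicalType)
    (theta : partial_action (free_group A) X) : Prop :=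
  forall u v : free_group A,
    fg_length (u * v)%g = (fg_length u + fg_length v)%N ->
    pdom theta (u * v)^-1%g =
      [set x | pdom theta v^-1%g x /\ pdom theta u^-1%g (pact theta v x)] /\
    forall x, pdom theta (u * v)^-1%g x ->
      pact theta (u * v)%g x = pact theta u (pact theta v x).

Section LocallyConstant.
Variables (Y : topologicalType) (K : fieldType).

Definition locally_constant (f : Y -> K) : Prop :=
  forall y, \forall z \near y, f z = f y.

(* For locally constant [f] the set where [f] is nonzero is clopen, so it is the
   support of [f]. *)
Definition lcc_pred : {pred Y -> K^o} :=
  fun f => `[< locally_constant f /\ compact [set y | f y != 0] >].

Lemma lccP (f : Y -> K) :
  reflect (locally_constant f /\ compact [set y | f y != 0]) (f \in lcc_pred).
Proof. exact: asboolP. Qed.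

Lemma locally_constant_closed (f : Y -> K) (P : K -> Prop) :
  locally_constant f -> closed [set y | P (f y)].
Proof.
move=> lf; rewrite -[X in closed X]setCK; apply: open_closedC.
rewrite openE => y /= nP; rewrite /interior.
by apply: filterS (lf y) => z /= ->.
Qed.

Lemma locally_constant2 (op : K -> K -> K) (f g : Y -> K) :
  locally_constant f -> locally_constant g ->
  locally_constant (fun y => op (f y) (g y)).
Proof.
move=> lf lg y; near=> z; congr op; near: z; [exact: lf|exact: lg].
Unshelve. all: by end_near. Qed.

Lemma lcc_pred_sub (f : Y -> K) (B : set Y) : locally_constant f ->
  compact B -> [set y | f y != 0] `<=` B -> f \in lcc_pred.
Proof.
move=> lf cB sB; apply/lccP; split=> //; apply: subclosed_compact sB => //.
exact: (locally_constant_closed (P := fun a => a != 0)).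
Qed.

Lemma lcc_submod_closed : GRing.submod_closed lcc_pred.
Proof.
split=> [|a f g /lccP[lf cf] /lccP[lg cg]].
  apply/lccP; split; first by move=> y; near=> z.
  rewrite (_ : [set _ | _] = set0); first exact: compact0.
  by apply/seteqP; split=> y //=; rewrite eqxx.
apply: lcc_pred_sub (compactU cf cg) _ => [|y /=].
  exact: (@locally_constant2 (fun u v => a * u + v)).
apply: contraPP => /not_orP[/negP/negPn/eqP fy /negP/negPn/eqP gy].
by apply/negP/negPn; rewrite /GRing.add /= /GRing.scale /= fy gy scaler0 addr0.
Unshelve. all: by end_near. Qed.

HB.instance Definition _ :=
  GRing.isSubmodClosed.Build K (Y -> K^o) lcc_pred lcc_submod_closed.

Record lcc := Lcc { lcc_fun :> Y -> K^o; lcc_mem : lcc_fun \in lcc_pred }.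

HB.instance Definition _ := [isSub for lcc_fun].
HB.instance Definition _ := [Choice of lcc by <:].
HB.instance Definition _ := [SubChoice_isSubLmodule of lcc by <:].

Lemma lcc_inj : injective lcc_fun. Proof. exact: val_inj. Qed.
Lemma lcc_funD (f g : lcc) : lcc_fun (f + g) = lcc_fun f + lcc_fun g.
Proof. by []. Qed.
Lemma lcc_funZ a (f : lcc) : lcc_fun (a *: f) = a *: lcc_fun f.
Proof. by []. Qed.

Lemma lccM (f g : Y -> K) : f \in lcc_pred -> g \in lcc_pred ->
  (fun y => f y * g y) \in lcc_pred.
Proof.
move=> /lccP[lf cf] /lccP[lg cg].
apply: lcc_pred_sub cf _ => [|y /=]; first exact: locally_constant2.
by apply: contraNN => /eqP->; rewrite mul0r.
Qed.

End LocallyConstant.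
(* [gcomp a b] is relevant only for composable pairs, [gsrc a = grng b]. *)
Record groupoid (Ob Arr : Type) := Groupoid {
  gsrc : Arr -> Ob;
  grng : Arr -> Ob;
  gcomp : Arr -> Arr -> Arr;
  ginv : Arr -> Arr;
  gunit : Ob -> Arr;
  gsrc_comp : forall a b, gsrc a = grng b -> gsrc (gcomp a b) = gsrc b;
  grng_comp : forall a b, gsrc a = grng b -> grng (gcomp a b) = grng a;
  gcompA : forall a b c, gsrc a = grng b -> gsrc b = grng c ->
    gcomp (gcomp a b) c = gcomp a (gcomp b c);
  gsrc_unit : forall x, gsrc (gunit x) = x;
  grng_unit : forall x, grng (gunit x) = x;
  gcomp1 : forall a, gcomp (gunit (grng a)) a = a;
  gcompr1 : forall a, gcomp a (gunit (gsrc a)) = a;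
  gsrc_inv : forall a, gsrc (ginv a) = grng a;
  grng_inv : forall a, grng (ginv a) = gsrc a;
  gcompV : forall a, gcomp (ginv a) a = gunit (gsrc a);
  gcomprV : forall a, gcomp a (ginv a) = gunit (grng a) }.

(* If [f] has compact support and the range fibres are closed and discrete, the
   sum has finitely many nonzero terms; otherwise its value is irrelevant. *)
Definition convolution (K : fieldType) (Ob : Type) (Arr : choiceType)
    (gpd : groupoid Ob Arr) (f g : Arr -> K) : Arr -> K :=
  fun c => \sum_(a \in [set a | grng gpd a = grng gpd c])
             f a * g (gcomp gpd (ginv gpd a) c).

Section TransformationGroupoid.
Variables (G : groupType) (X : topologicalType) (theta : partial_action G X).

Definition arrows : set (discrete_topology G * X) :=
  [set gx | pdom theta (gx.1 : G)^-1%g gx.2].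

(* As a type, [arrows] carries the subspace topology. *)
Notation arr := (set_type arrows).

Definition arr_elt (a : arr) : G := (val a).1.
Definition arr_src (a : arr) : X := (val a).2.
Definition arr_rng (a : arr) : X := pact theta (arr_elt a) (arr_src a).

Lemma arr_dom (a : arr) : pdom theta (arr_elt a)^-1%g (arr_src a).
Proof. by case: a => gx p; exact: set_mem p. Qed.

Definition mk_arr (g : G) (x : X) (H : pdom theta g^-1%g x) : arr :=
  exist _ ((g, x) : discrete_topology G * X) (mem_set H).

Lemma arr_eq (a b : arr) :
  arr_elt a = arr_elt b -> arr_src a = arr_src b -> a = b.
Proof.
move=> e1 e2; apply: val_inj; rewrite [LHS]surjective_pairing.
by rewrite [RHS]surjective_pairing; congr pair.
Qed.

(* [(g, theta_h x) (h, x) = (g h, x)]; the default value [b] is used only when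
   the two arrows do not compose. *)
Definition arr_comp (a b : arr) : arr :=
  insubd b ((arr_elt a * arr_elt b)%g, arr_src b).

Lemma pact_dom g x : pdom theta g^-1%g x -> pdom theta g (pact theta g x).
Proof. by case: (pact_bij theta g) => + _ _; exact. Qed.

Lemma pact_domV g x : pdom theta g x -> pdom theta g^-1%g (pact theta g^-1%g x).
Proof. by move=> dx; apply: pact_dom; rewrite invgK. Qed.

Lemma pactVV g x : pdom theta g x -> pact theta g (pact theta g^-1%g x) = x.
Proof. by move=> dx; rewrite -{1}[g]invgK pactV // invgK. Qed.

Lemma pdomT x : pdom theta 1%g x.
Proof. by rewrite pdom1. Qed.

Lemma arr_inv_dom (a : arr) : pdom theta (arr_elt a)^-1^-1%g (arr_rng a).
Proof. by rewrite invgK; apply/pact_dom/arr_dom. Qed.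

Definition arr_inv (a : arr) : arr := mk_arr (arr_inv_dom a).

Lemma arr_unit_dom x : pdom theta (1%g : G)^-1%g x.
Proof. by rewrite invg1; exact: pdomT. Qed.

Definition arr_unit (x : X) : arr := mk_arr (arr_unit_dom x).

Lemma pair_arr g x (a : arr) : pdom theta g^-1%g x ->
  arr_elt (insubd a ((g, x) : discrete_topology G * X)) = g /\
  arr_src (insubd a ((g, x) : discrete_topology G * X)) = x.
Proof. by move=> dx; rewrite /arr_elt /arr_src insubdK //; apply: mem_set. Qed.

Lemma arr_compE a b : arr_src a = arr_rng b ->
  arr_elt (arr_comp a b) = (arr_elt a * arr_elt b)%g /\
  arr_src (arr_comp a b) = arr_src b.
Proof.
move=> ab; apply: pair_arr.
by have [|//] := pactM (arr_dom b) (g := arr_elt a); rewrite -/(arr_rng b) -ab; exact: arr_dom.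
Qed.

Lemma arr_rng_comp a b :
  arr_src a = arr_rng b -> arr_rng (arr_comp a b) = arr_rng a.
Proof.
move=> ab; have [e1 e2] := arr_compE ab; rewrite /arr_rng e1 e2 ab.
by have [|//] := pactM (arr_dom b) (g := arr_elt a); rewrite -/(arr_rng b) -ab; exact: arr_dom.
Qed.

Lemma arr_rng_inv a : arr_rng (arr_inv a) = arr_src a.
Proof. exact/pactV/arr_dom. Qed.

Lemma arr_rng_unit x : arr_rng (arr_unit x) = x.
Proof. exact: pact1. Qed.

Lemma arr_src_comp a b :
  arr_src a = arr_rng b -> arr_src (arr_comp a b) = arr_src b.
Proof. by case/arr_compE. Qed.

Lemma arr_compA a b c : arr_src a = arr_rng b -> arr_src b = arr_rng c ->
  arr_comp (arr_comp a b) c = arr_comp a (arr_comp b c).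
Proof.
move=> ab bc; have abc : arr_src (arr_comp a b) = arr_rng c by rewrite arr_src_comp.
have abc' : arr_src a = arr_rng (arr_comp b c) by rewrite arr_rng_comp.
have [[e1 e2] [e3 e4]] := (arr_compE abc, arr_compE abc').
have [[e5 e6] [e7 e8]] := (arr_compE ab, arr_compE bc).
by apply: arr_eq; rewrite ?e1 ?e2 ?e3 ?e4 ?e5 ?e7 ?e8 ?mulgA.
Qed.

Lemma arr_comp1 a : arr_comp (arr_unit (arr_rng a)) a = a.
Proof.
have [|e1 e2] := @arr_compE (arr_unit (arr_rng a)) a; first by [].
by apply: arr_eq; rewrite ?e1 ?e2 // [arr_elt (arr_unit _)]/arr_elt /= mul1g.
Qed.

Lemma arr_compr1 a : arr_comp a (arr_unit (arr_src a)) = a.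
Proof.
have [|e1 e2] := @arr_compE a (arr_unit (arr_src a)); first by rewrite arr_rng_unit.
by apply: arr_eq; rewrite ?e1 ?e2 // [arr_elt (arr_unit _)]/arr_elt /= mulg1.
Qed.

Lemma arr_compV a : arr_comp (arr_inv a) a = arr_unit (arr_src a).
Proof.
have [|e1 e2] := @arr_compE (arr_inv a) a; first by [].
by apply: arr_eq; rewrite ?e1 ?e2 // [arr_elt (arr_inv _)]/arr_elt /= mulVg.
Qed.

Lemma arr_comprV a : arr_comp a (arr_inv a) = arr_unit (arr_rng a).
Proof.
have [|e1 e2] := @arr_compE a (arr_inv a); first by rewrite arr_rng_inv.
by apply: arr_eq; rewrite ?e1 ?e2 // [arr_elt (arr_inv _)]/arr_elt /= mulgV.
Qed.

Definition transformation_groupoid : groupoid X arr :=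
  @Groupoid X arr arr_src arr_rng arr_comp arr_inv arr_unit
    arr_src_comp arr_rng_comp arr_compA (fun=> erefl) arr_rng_unit
    arr_comp1 arr_compr1 (fun=> erefl) arr_rng_inv arr_compV arr_comprV.

End TransformationGroupoid.

Arguments arr_elt {G X theta} a.
Arguments arr_src {G X theta} a.
Arguments arr_rng {G X theta} a.

Notation arrow theta := (set_type (arrows theta)).

Lemma discrete_compact_finite (T : discreteTopologicalType) (A : set T) :
  compact A -> finite_set A.
Proof.
rewrite compact_near_coveringP => cA.
pose F := filter_from (@finite_set T)
  (fun S => [set B : set T | S `<=` B /\ finite_set B]).
have FF : Filter F.
  apply: filter_from_filter; first by exists set0; exact: finite_set0.
  move=> S S' fS fS'; exists (S `|` S'); first by rewrite finite_setU.
  by move=> B; rewrite /= subUset => -[[? ?] ?].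
have [|S fS SA] := cA _ F (fun B x => B x) FF.
  move=> x Ax; exists ([set x], [set B : set T | [set x] `<=` B /\ finite_set B]) => /=.
    by split; [exact: discrete_set1 | exists [set x]; [exact: finite_set1|]].
  by move=> [y B] /= [-> [+ _]]; apply.
by have /sub_finite_set := SA S (conj (@subset_refl _ _) fS); exact.
Qed.
Lemma fsum_seq (K : fieldType) (I : choiceType) (phi : I -> K) (r : seq I) :
  uniq r -> (forall i, i \notin r -> phi i = 0) ->
  \sum_(i \in [set: I]) phi i = \sum_(i <- r) phi i.
Proof.
move=> ur hr; rewrite (fsbigE r) // => [|i _]; last exact: hr.
by apply: eq_bigl => i; rewrite in_setT.
Qed.

Section Skew.
Variables (K : fieldType) (G : groupType) (X : topologicalType).
Variable theta : partial_action G X.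

(* [alpha g f] is f o theta_{g^-1} on X_g, extended by 0 to X. *)
Definition alpha (g : G) (f : X -> K^o) : X -> K^o :=
  fun x => if x \in pdom theta g then f (pact theta g^-1%g x) else 0.

(* [F : G -> X -> K] stands for the formal sum of the [F g] delta_g. Since X_g
   is clopen, KX_g consists of the functions in KX vanishing off X_g. *)
Definition skew_pred : {pred G -> X -> K^o} :=
  fun F => `[< [/\ finite_set [set g | F g != 0],
    forall g, F g \in @lcc_pred X K &
    forall g x, ~ pdom theta g x -> F g x = 0] >].

Lemma skewP (F : G -> X -> K^o) :
  reflect [/\ finite_set [set g | F g != 0],
    forall g, F g \in @lcc_pred X K &
    forall g x, ~ pdom theta g x -> F g x = 0] (F \in skew_pred).
Proof. exact: asboolP. Qed.

Lemma skew_supp F : F \in skew_pred ->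
  exists2 r : seq G, uniq r & forall g, g \notin r -> F g = 0.
Proof.
case/skewP=> /finite_seqP[s es] _ _; exists (undup s); first exact: undup_uniq.
move=> g; rewrite mem_undup => gs; apply/eqP/negPn/negP => Fg.
by have : [set g | F g != 0] g by []; rewrite es /= (negbTE gs).
Qed.

Lemma skew_predI F (r : seq G) : (forall g, g \notin r -> F g = 0) ->
  (forall g, F g \in @lcc_pred X K) ->
  (forall g x, ~ pdom theta g x -> F g x = 0) -> F \in skew_pred.
Proof.
move=> hr hl h0; apply/skewP; split=> //.
apply: (@sub_finite_set _ _ [set` r]) => // g /=; apply: contraR => gr.
by rewrite hr // eqxx.
Qed.

Lemma skew_submod_closed : GRing.submod_closed skew_pred.
Proof.
split=> [|a F F' sF sF'].
  by apply: (@skew_predI _ [::]) => // g; exact: rpred0.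
have [[r ur hr] [r' ur' hr']] := (skew_supp sF, skew_supp sF').
case/skewP: sF sF' => _ lF zF /skewP[_ lF' zF'].
apply: (@skew_predI _ (r ++ r')) => [g|g|g x nx].
- rewrite mem_cat negb_or => /andP[/hr e /hr' e'].
  have -> : (a *: F + F') g = a *: F g + F' g by [].
  by rewrite e e' scaler0 addr0.
- have -> : (a *: F + F') g = a *: F g + F' g by [].
  exact: rpredD (rpredZ _ _) _.
- have -> : (a *: F + F') g x = a *: F g x + F' g x by [].
  by rewrite zF // zF' // scaler0 addr0.
Qed.

HB.instance Definition _ := GRing.isSubmodClosed.Build K
  (G -> X -> K^o) skew_pred skew_submod_closed.

Record skew := Skew { skew_fun :> G -> X -> K^o; skew_mem : skew_fun \in skew_pred }.

HB.instance Definition _ := [isSub for skew_fun].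
HB.instance Definition _ := [Choice of skew by <:].
HB.instance Definition _ := [SubChoice_isSubLmodule of skew by <:].

Lemma skew_inj : injective skew_fun. Proof. exact: val_inj. Qed.
Lemma skew_funD (F F' : skew) : skew_fun (F + F') = skew_fun F + skew_fun F'.
Proof. by []. Qed.
Lemma skew_funZ a (F : skew) : skew_fun (a *: F) = a *: skew_fun F.
Proof. by []. Qed.

(* The coefficient at delta_k of the bilinear extension of
   (f delta_g) (f' delta_h) = alpha_g (alpha_{g^-1} f * f') delta_{gh}. *)
Definition skew_mul (F F' : G -> X -> K^o) : G -> X -> K^o := fun k =>
  \sum_(g \in [set: G]) alpha g (alpha g^-1%g (F g) * F' (g^-1 * k)%g).

Definition skew_one : G -> X -> K^o := fun g => if g == 1%g then cst 1 else 0.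

Definition skew_delta (g : G) (f : X -> K^o) : G -> X -> K^o :=
  fun h => if h == g then f else 0.

Lemma skew_mul_delta g h (f f' : X -> K^o) :
  skew_mul (skew_delta g f) (skew_delta h f') =
  skew_delta (g * h)%g (alpha g (alpha g^-1%g f * f')).
Proof.
have a0 g' : alpha g' 0 = 0.
  by apply/funext=> x; rewrite /alpha; case: ifP.
apply/funext=> k; rewrite /skew_mul (fsbigE [:: g]) //= => [|g' _].
  rewrite big_mkcond /= big_seq1 in_setT /skew_delta eqxx.
  rewrite (can2_eq (mulVKg g) (mulKg g)).
  by case: ifP => // _; rewrite mulr0 a0.
by rewrite inE /skew_delta => /negbTE ->; rewrite a0 mul0r a0.
Qed.

Lemma pact_open_continuous g x : pdom theta g^-1%g x ->
  {for x, continuous (pact theta g)}.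
Proof.
move=> dx; have := @pact_continuous _ _ theta g.
rewrite continuous_open_subspace; last by case: (pdom_clopen theta g^-1%g).
by apply; rewrite inE.
Qed.

Lemma near_pdom g x : pdom theta g x -> \forall z \near x, pdom theta g z.
Proof. by move=> dx; apply: open_nbhs_nbhs; split=> //; case: (pdom_clopen theta g). Qed.

Lemma near_npdom g x : ~ pdom theta g x -> \forall z \near x, ~ pdom theta g z.
Proof.
move=> dx; apply: open_nbhs_nbhs; split=> //; apply: closed_openC.
by case: (pdom_clopen theta g).
Qed.

Lemma alpha_lc g (f : X -> K^o) : locally_constant f -> locally_constant (alpha g f).
Proof.
move=> lf x; have [dx|dx] := pselect (pdom theta g x).
  have dx' : pdom theta (g^-1)^-1%g x by rewrite invgK.
  have := pact_open_continuous dx' (lf (pact theta g^-1%g x)).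
  move=> nf; near=> z; rewrite /alpha !mem_set //; last by near: z; exact: near_pdom.
  by near: z.
near=> z; rewrite /alpha !memNset //; near: z; exact: near_npdom.
Unshelve. all: by end_near. Qed.

Lemma alphaN g f x : ~ pdom theta g x -> alpha g f x = 0.
Proof. by move=> dx; rewrite /alpha memNset. Qed.

Lemma alphaT g f x : pdom theta g x -> alpha g f x = f (pact theta g^-1%g x).
Proof. by move=> dx; rewrite /alpha mem_set. Qed.

Lemma skew_term F F' g k x : F \in skew_pred ->
  alpha g (alpha g^-1%g (F g) * F' (g^-1 * k)%g) x =
  F g x * F' (g^-1 * k)%g (pact theta g^-1%g x).
Proof.
case/skewP=> _ _ zF; have [dx|dx] := pselect (pdom theta g x); last first.
  by rewrite alphaN // zF // mul0r.
rewrite alphaT // /GRing.mul /= alphaT; last exact: pact_domV.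
by rewrite invgK pactVV.
Qed.

Lemma skew_term0 F F' g k : F \in skew_pred -> F g = 0 ->
  alpha g (alpha g^-1%g (F g) * F' (g^-1 * k)%g) = 0.
Proof. by move=> sF F0; apply/funext => x; rewrite skew_term // F0 mul0r. Qed.

Lemma skew_mulE F F' r k x : F \in skew_pred -> uniq r ->
  (forall g, g \notin r -> F g = 0) ->
  skew_mul F F' k x = \sum_(g <- r) F g x * F' (g^-1 * k)%g (pact theta g^-1%g x).
Proof.
move=> sF ur hr; rewrite /skew_mul (fsbigE r) // => [|g _ gr]; last first.
  by apply: skew_term0 => //; exact: hr.
rewrite fct_sumE; under eq_bigl do rewrite in_setT.
by apply: eq_bigr => g _; exact: skew_term.
Qed.

Lemma skew_mulN F F' k x : F \in skew_pred -> F' \in skew_pred ->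
  ~ pdom theta k x -> skew_mul F F' k x = 0.
Proof.
move=> sF sF' nx; have [r ur hr] := skew_supp sF; rewrite (skew_mulE _ _ _ sF ur hr).
case/skewP: sF sF' => _ lF zF /skewP[_ lF' zF'].
apply: big1 => g _; have [dx|dx] := pselect (pdom theta g x); last first.
  by rewrite zF // mul0r.
rewrite zF' ?mulr0 //; apply: contra_not nx => dy.
have dyV := pact_domV dx; have dz := pact_domV dy.
have e : (pact theta (g^-1 * k) (pact theta (g^-1 * k)^-1 (pact theta g^-1 x)) = pact theta g^-1 x)%g.
  exact: pactVV.
have [] := pactM dz (g := g); rewrite e // mulVKg => dk.
by rewrite pactVV // => <-; apply: pact_dom.
Qed.

Lemma skew_mulA F1 F2 F3 : F1 \in skew_pred -> F2 \in skew_pred ->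
  F3 \in skew_pred -> skew_mul F1 F2 \in skew_pred -> skew_mul F2 F3 \in skew_pred ->
  skew_mul F1 (skew_mul F2 F3) = skew_mul (skew_mul F1 F2) F3.
Proof.
move=> s1 s2 s3 s12 s23; apply/funext=> k; apply/funext=> x.
have [r ur hr] := skew_supp s1; have [t ut ht] := skew_supp s2.
pose q := undup [seq (g * l)%g | g <- r, l <- t].
have uq : uniq q by exact: undup_uniq.
have hq g l : g \in r -> l \in t -> (g * l)%g \in q.
  by move=> gr lt; rewrite mem_undup; apply/allpairsP; exists (g, l).
have hq0 h : h \notin q -> skew_mul F1 F2 h = 0.
  move=> nq; apply/funext => y; rewrite (skew_mulE _ _ _ s1 ur hr) big1_seq // => g /andP[_ gr].
  rewrite ht ?mulr0 //; apply: contra nq => gh.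
  by rewrite -[h](mulVKg g); exact: hq.
rewrite (skew_mulE _ _ _ s1 ur hr) (skew_mulE _ _ _ s12 uq hq0).
under [RHS]eq_bigr do rewrite (skew_mulE _ _ _ s1 ur hr) mulr_suml.
rewrite [RHS]exchange_big /=; apply: eq_big_seq => g gr.
rewrite (skew_mulE _ _ _ s2 ut ht) mulr_sumr.
pose phi l := F1 g x * (F2 l (pact theta g^-1%g x) *
  F3 (l^-1 * (g^-1 * k))%g (pact theta l^-1%g (pact theta g^-1%g x))).
rewrite -(@fsum_seq _ _ phi t ut); last first.
  by move=> l lt; rewrite /phi ht // mul0r mulr0.
rewrite (@reindex_fsbigT _ _ _ G G (fun h => g^-1 * h)%g) /=; last first.
  by exists (fun h => g * h)%g => h; rewrite ?mulKg ?mulVKg.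
rewrite (@fsum_seq _ _ _ q uq); last first.
  move=> h nh; rewrite /phi ht ?mul0r ?mulr0 //; apply: contra nh => gh.
  by rewrite -[h](mulVKg g); exact: hq.
apply: eq_bigr => h _; rewrite /phi mulrA -mulrA.
case/skewP: s1 s2 => _ _ z1 /skewP[_ _ z2].
have [dx|dx] := pselect (pdom theta g x); last by rewrite z1 // !mul0r.
have [dy|dy] := pselect (pdom theta (g^-1 * h)%g (pact theta g^-1%g x)); last first.
  by rewrite z2 // !(mul0r, mulr0).
have [||_] := @pactM _ _ theta ((g^-1 * h)^-1)%g g^-1%g x; rewrite ?invgK // => <-.
by rewrite invgM invgK -!mulgA mulgV mulg1 mulVKg mulrA.
Qed.

Hypothesis cX : compact [set: X].

Lemma lc_lcc (f : X -> K) : locally_constant f -> f \in @lcc_pred X K.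
Proof. by move=> lf; apply: lcc_pred_sub cX _. Qed.

Lemma alpha_lcc g f : f \in @lcc_pred X K -> alpha g f \in @lcc_pred X K.
Proof. by case/lccP=> lf _; apply/lc_lcc/alpha_lc. Qed.

Lemma skew_one_mem : skew_one \in skew_pred.
Proof.
apply: (@skew_predI _ [:: 1%g]) => [g|g|g x].
- by rewrite inE /skew_one => /negbTE ->.
- apply: lc_lcc => x; rewrite /skew_one; case: eqP => _; by near=> y.
- by rewrite /skew_one; case: eqP => // ->; rewrite pdom1 => /(_ I).
Unshelve. all: by end_near. Qed.

Lemma skew_mul_mem F F' : F \in skew_pred -> F' \in skew_pred ->
  skew_mul F F' \in skew_pred.
Proof.
move=> sF sF'; have [[r ur hr] [t ut ht]] := (skew_supp sF, skew_supp sF').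
apply: (@skew_predI _ [seq (g * l)%g | g <- r, l <- t]) => [k nk|k|k x].
- apply/funext => x; rewrite (skew_mulE _ _ _ sF ur hr) big1_seq // => g /andP[_ gr].
  rewrite ht ?mulr0 //; apply: contra nk => gk.
  by rewrite -[k](mulVKg g); apply/allpairsP; exists (g, g^-1 * k)%g.
- rewrite /skew_mul (fsbigE r) // => [|g _ gr]; last first.
    by apply: skew_term0 => //; exact: hr.
  case/skewP: sF sF' => _ lF zF /skewP[_ lF' zF'].
  apply: rpred_sum => g _; apply: alpha_lcc.
  exact: (lccM (alpha_lcc _ (lF g)) (lF' _)).
- exact: skew_mulN.
Qed.

Lemma skew_mul1 F : F \in skew_pred -> skew_mul skew_one F = F.
Proof.
move=> sF; apply/funext=> k; apply/funext=> x.
rewrite (@skew_mulE _ _ [:: 1%g]) //; last 2 first.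
- exact: skew_one_mem.
- by move=> g; rewrite inE /skew_one => /negbTE ->.
by rewrite big_seq1 /skew_one eqxx mul1r invg1 mul1g pact1.
Qed.

Lemma skew_mulr1 F : F \in skew_pred -> skew_mul F skew_one = F.
Proof.
move=> sF; apply/funext=> k; apply/funext=> x.
have [r ur hr] := skew_supp sF.
have hr' g : g \notin k :: rem k r -> F g = 0.
  rewrite inE negb_or => /andP[gk grk]; apply: hr; apply: contra grk => gr.
  by rewrite mem_rem_uniq // inE gk.
have ur' : uniq (k :: rem k r) by rewrite /= mem_rem_uniqF // rem_uniq.
rewrite (skew_mulE _ _ _ sF ur' hr') big_cons big1_seq => [|g /andP[_ gr]].
  by rewrite mulVg /skew_one eqxx mulr1 addr0.
rewrite /skew_one; case: eqP => [e|_]; last exact: mulr0.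
move: gr; rewrite mem_rem_uniq // inE => /andP[/eqP[]].
by rewrite -[RHS](mulVKg g) e mulg1.
Qed.

Lemma skew_mulDl F1 F2 F3 : F1 \in skew_pred -> F2 \in skew_pred ->
  skew_mul (F1 + F2) F3 = skew_mul F1 F3 + skew_mul F2 F3.
Proof.
move=> s1 s2; apply/funext=> k; apply/funext=> x.
have [[r ur hr] [t ut ht]] := (skew_supp s1, skew_supp s2).
have uq : uniq (undup (r ++ t)) by exact: undup_uniq.
have h1 g : g \notin undup (r ++ t) -> F1 g = 0.
  by rewrite mem_undup mem_cat negb_or => /andP[/hr].
have h2 g : g \notin undup (r ++ t) -> F2 g = 0.
  by rewrite mem_undup mem_cat negb_or => /andP[_ /ht].
have -> : (skew_mul F1 F3 + skew_mul F2 F3) k x =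
  skew_mul F1 F3 k x + skew_mul F2 F3 k x by [].
rewrite (skew_mulE _ _ _ s1 uq h1) (skew_mulE _ _ _ s2 uq h2).
rewrite (skew_mulE _ _ _ _ uq); first last.
- move=> g hg; have -> : (F1 + F2) g = F1 g + F2 g by [].
  by rewrite h1 // h2 // addr0.
- exact: rpredD.
by rewrite -big_split; apply: eq_bigr => g _; rewrite [LHS]mulrDl.
Qed.

Lemma skew_mulDr F1 F2 F3 : F1 \in skew_pred ->
  skew_mul F1 (F2 + F3) = skew_mul F1 F2 + skew_mul F1 F3.
Proof.
move=> s1; apply/funext=> k; apply/funext=> x.
have [r ur hr] := skew_supp s1.
have -> : (skew_mul F1 F2 + skew_mul F1 F3) k x =
  skew_mul F1 F2 k x + skew_mul F1 F3 k x by [].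
rewrite !(skew_mulE _ _ _ s1 ur hr).
by rewrite -big_split; apply: eq_bigr => g _; rewrite [LHS]mulrDr.
Qed.

Lemma skew_mulZl a F1 F2 : F1 \in skew_pred ->
  skew_mul (a *: F1) F2 = a *: skew_mul F1 F2.
Proof.
move=> s1; apply/funext=> k; apply/funext=> x.
have [r ur hr] := skew_supp s1.
have -> : (a *: skew_mul F1 F2) k x = a * skew_mul F1 F2 k x by [].
rewrite (skew_mulE _ _ _ s1 ur hr) (skew_mulE _ _ _ _ ur); first last.
- move=> g hg; have -> : (a *: F1) g = a *: F1 g by [].
  by rewrite hr // scaler0.
- exact: rpredZ.
by rewrite mulr_sumr; apply: eq_bigr => g _; rewrite mulrA.
Qed.

Lemma skew_mulZr a F1 F2 : F1 \in skew_pred ->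
  skew_mul F1 (a *: F2) = a *: skew_mul F1 F2.
Proof.
move=> s1; apply/funext=> k; apply/funext=> x.
have [r ur hr] := skew_supp s1.
have -> : (a *: skew_mul F1 F2) k x = a * skew_mul F1 F2 k x by [].
rewrite !(skew_mulE _ _ _ s1 ur hr) mulr_sumr; apply: eq_bigr => g _.
by rewrite mulrCA.
Qed.

End Skew.

Arguments skew_pred K {G X} theta.

Section SkewGroupoid.
Variables (K : fieldType) (G : groupType) (X : topologicalType).
Variable theta : partial_action G X.
Local Notation arr := (arrow theta).
Local Notation gpd := (transformation_groupoid theta).

Definition arr_ext (f : arr -> K) (g : G) (y : X) : K :=
  oapp f 0 (insub ((g, y) : discrete_topology G * X)).

Definition skew_of_fun (f : arr -> K) : G -> X -> K^o :=
  fun g => alpha theta g (arr_ext f g).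

Definition fun_of_skew (F : G -> X -> K^o) : arr -> K^o :=
  fun a => F (arr_elt a) (arr_rng a).

Lemma arr_extE (f : arr -> K) a : arr_ext f (arr_elt a) (arr_src a) = f a.
Proof.
rewrite /arr_ext (_ : (_, _) = val a); last by rewrite [RHS]surjective_pairing.
by rewrite valK.
Qed.

Lemma arr_extN (f : arr -> K) g y :
  ~ pdom theta g^-1%g y -> arr_ext f g y = 0.
Proof. by move=> ny; rewrite /arr_ext insubN //; apply/negP => /set_mem. Qed.

Lemma skew_of_funE (f : arr -> K) a :
  skew_of_fun f (arr_elt a) (arr_rng a) = f a.
Proof.
have da := arr_dom a; rewrite /skew_of_fun alphaT; last exact: pact_dom.
by rewrite pactV // arr_extE.
Qed.

Lemma skew_of_funN (f : arr -> K) g x :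
  ~ pdom theta g x -> skew_of_fun f g x = 0.
Proof. exact: alphaN. Qed.

Lemma arr_of_rng g x : pdom theta g x ->
  exists2 a : arr, arr_elt a = g & arr_rng a = x.
Proof.
move=> dx; exists (mk_arr (pact_domV dx)) => //.
by rewrite /arr_rng [arr_elt _]/arr_elt [arr_src _]/arr_src /= pactVV.
Qed.

Lemma fun_of_skewK F : F \in skew_pred K theta -> skew_of_fun (fun_of_skew F) = F.
Proof.
case/skewP=> _ _ zF; apply/funext=> g; apply/funext=> x.
have [dx|dx] := pselect (pdom theta g x); last by rewrite skew_of_funN ?zF.
by have [a <- <-] := arr_of_rng dx; rewrite skew_of_funE.
Qed.

Lemma skew_of_funK f : fun_of_skew (skew_of_fun f) = f.
Proof. by apply/funext=> a; exact: skew_of_funE. Qed.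

Lemma arr_elt_continuous :
  continuous (@arr_elt _ _ theta : arr -> discrete_topology G).
Proof.
move=> a; apply: (@continuous_comp arr (discrete_topology G * X)%type _ val fst).
  exact: initial_continuous.
exact: cvg_fst.
Qed.

Lemma arr_src_continuous : continuous (@arr_src _ _ theta).
Proof.
move=> a; apply: (@continuous_comp arr (discrete_topology G * X)%type _ val snd).
  exact: initial_continuous.
exact: cvg_snd.
Qed.

Lemma near_arr_elt (a : arr) : \forall b \near a, arr_elt b = arr_elt a.
Proof.
apply: (@arr_elt_continuous a [set g | g = arr_elt a]).
exact: (@discrete_set1 (discrete_topology G)).
Qed.

Lemma near_slice (a : arr) (U : set arr) : nbhs a U ->
  \forall y \near arr_src a, forall b : arr,
    arr_elt b = arr_elt a -> arr_src b = y -> U b.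
Proof.
case=> V /= [[W oW <-] Wa] WU.
have nW : nbhs ((val a) : discrete_topology G * X) W by exact: open_nbhs_nbhs.
have cs : continuous (fun y : X => ((arr_elt a, y) : discrete_topology G * X)).
  move=> y; apply: (@cvg_pair X (discrete_topology G) X (nbhs y) (nbhs (arr_elt a : discrete_topology G)) (nbhs y) _ _ _ (fun=> arr_elt a : discrete_topology G) id).
    exact: cvg_cst.
  exact: cvg_id.
have := cs (arr_src a) W.
rewrite /= (_ : (_, _) = val a); last by rewrite [RHS]surjective_pairing.
move=> /(_ nW) nW'; near=> y => b eb sb; apply: WU.
have Wy : W (arr_elt a, y) by near: y; exact: nW'.
suff e : set_val b = (arr_elt a, y) by rewrite /preimage /= e.
by rewrite -eb -sb; exact: surjective_pairing.
Unshelve. all: by end_near. Qed.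

Lemma arr_ext_lc (f : arr -> K) g :
  locally_constant f -> locally_constant (arr_ext f g).
Proof.
move=> lf y; have [dy|dy] := pselect (pdom theta g^-1%g y); last first.
  by near=> z; rewrite !arr_extN //; near: z; exact: near_npdom.
have := near_slice (lf (mk_arr dy)) => /= ns.
near=> z; have dz : pdom theta g^-1%g z by near: z; exact: near_pdom.
rewrite -[g in LHS]/(arr_elt (mk_arr dz)) -[z in LHS]/(arr_src (mk_arr dz)) arr_extE.
rewrite -[g in RHS]/(arr_elt (mk_arr dy)) -[y in RHS]/(arr_src (mk_arr dy)) arr_extE.
have : forall b : arr, arr_elt b = g -> arr_src b = z -> f b = f (mk_arr dy).
  by near: z.
exact.
Unshelve. all: by end_near. Qed.

Lemma fun_of_skew_lc F : F \in skew_pred K theta -> locally_constant (fun_of_skew F).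
Proof.
case/skewP=> _ lF _ a; have /lccP[lFa _] := lF (arr_elt a).
have := pact_open_continuous (arr_dom a) (lFa (arr_rng a)).
move=> /arr_src_continuous na.
near=> b; rewrite /fun_of_skew /arr_rng.
have -> : arr_elt b = arr_elt a by near: b; exact: near_arr_elt.
by near: b.
Unshelve. all: by end_near. Qed.

Hypothesis cX : compact [set: X].

Lemma slice_compact g : compact [set a : arr | arr_elt a = g].
Proof.
have cg : compact (pdom theta g^-1%g).
  rewrite -[X in compact X]setTI; apply: compact_closedI => //.
  by case: (pdom_clopen theta g^-1%g).
move=> F PF Fg; have Fd : (arr_src @ F) (pdom theta g^-1%g).
  by rewrite /fmap /=; apply: filterS Fg => a /= ea; rewrite -ea; exact: arr_dom.
have [y [dy cy]] := cg _ (fmap_proper_filter _ PF) Fd.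
exists (mk_arr dy); split=> // A B FA /near_slice nB.
have FS : (arr_src @ F) (arr_src @` (A `&` [set a | arr_elt a = g])).
  have FAg : F (A `&` [set a | arr_elt a = g]) by exact: filterI.
  by rewrite /fmap /=; apply: filterS FAg => a Aa; exists a.
have [z [[b [Ab eb] <-] Bz]] := cy _ _ FS nB.
by exists b; split=> //; exact: Bz.
Qed.

Lemma skew_of_fun_mem f : f \in @lcc_pred arr K -> skew_of_fun f \in skew_pred K theta.
Proof.
case/lccP=> lf cf; apply/skewP; split=> [|g|]; last exact: skew_of_funN.
- have fin : finite_set ((@arr_elt _ _ theta : arr -> discrete_topology G)
      @` [set a | f a != 0]).
    apply: discrete_compact_finite; apply: continuous_compact cf.
    exact/continuous_subspaceT/arr_elt_continuous.
  apply: sub_finite_set fin => g /= /eqP Fg.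
  apply: contra_notP Fg => nf; apply/funext=> x.
  have [dx|dx] := pselect (pdom theta g x); last exact: skew_of_funN.
  have [a ea ra] := arr_of_rng dx; rewrite -ea -ra skew_of_funE.
  by apply/eqP/negPn/negP => fa; apply: nf; exists a.
- by apply: lc_lcc => //; apply/alpha_lc/arr_ext_lc.
Qed.

Lemma fun_of_skew_mem F :
  F \in skew_pred K theta -> fun_of_skew F \in @lcc_pred arr K.
Proof.
move=> sF; have [r ur hr] := skew_supp sF.
apply: (@lcc_pred_sub _ _ _ (\big[setU/set0]_(g <- r) [set a : arr | arr_elt a = g])).
- exact: fun_of_skew_lc.
- by apply: bigsetU_compact => g _; exact: slice_compact.
- move=> a /=; rewrite /fun_of_skew => Fa.
  have ar : arr_elt a \in r.
    by apply: contraNT Fa => /hr ->.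
  by rewrite -bigcup_seq; exists (arr_elt a).
Qed.

Lemma convolutionE (f f' : arr -> K) : f \in @lcc_pred arr K ->
  convolution gpd f f' = fun_of_skew (skew_mul theta (skew_of_fun f) (skew_of_fun f')).
Proof.
move=> lf; have sf := skew_of_fun_mem lf; have [r ur hr] := skew_supp sf.
apply/funext=> c; rewrite /fun_of_skew (skew_mulE _ _ _ sf ur hr).
set x := arr_rng c; set k := arr_elt c.
pose phi g := skew_of_fun f g x * skew_of_fun f' (g^-1 * k)%g (pact theta g^-1%g x).
rewrite -(@fsum_seq _ _ phi r ur); last by move=> g /hr fg; rewrite /phi fg mul0r.
rewrite -(@fsbig_widen _ _ _ _ (pdom theta ^~ x)) //; last first.
  by move=> g [_ /= dx]; rewrite /phi skew_of_funN // mul0r.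
pose j g : arr := insubd c ((g, pact theta g^-1%g x) : discrete_topology G * X).
have jE g : pdom theta g x -> arr_elt (j g) = g /\ arr_rng (j g) = x.
  move=> dx; have [e1 e2] := @pair_arr _ _ _ _ _ c (pact_domV dx).
  by rewrite /arr_rng e1 e2; split=> //; exact: pactVV.
rewrite /convolution (@reindex_fsbig _ _ _ _ _ j (pdom theta ^~ x)).
  apply: eq_fsbigr => g /set_mem dx; have [ej rj] := jE _ dx.
  rewrite /phi.
  have -> : skew_of_fun f g x = f (j g) by rewrite -(skew_of_funE f (j g)) ej rj.
  congr (_ * _).
  pose a := arr_comp (arr_inv (j g)) c.
  have cj : arr_src (arr_inv (j g)) = arr_rng c := rj.
  have [e1 _] := arr_compE cj.
  have ei : arr_elt (arr_inv (j g)) = (g^-1)%g.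
    by rewrite -[in RHS]ej.
  have ea : arr_elt a = (g^-1 * k)%g by rewrite e1 -ei.
  have ra : arr_rng a = pact theta g^-1%g x.
    rewrite arr_rng_comp // arr_rng_inv.
    by have [] := @pair_arr _ _ _ _ _ c (pact_domV dx).
  by rewrite -ea -ra skew_of_funE.
split=> [g /jE[_] //|g h /set_mem/jE[eg _] /set_mem/jE[eh _] jgh|a /= ra].
  by rewrite -eg jgh eh.
have dx : pdom theta (arr_elt a) x.
  by rewrite -[x]ra; exact/pact_dom/arr_dom.
exists (arr_elt a) => //; have [e1 e2] := @pair_arr _ _ _ _ _ c (pact_domV dx).
by apply: arr_eq; rewrite ?e1 ?e2 // -[x]ra; exact/pactV/arr_dom.
Qed.

Lemma convolution_mem (f f' : arr -> K) : f \in @lcc_pred arr K ->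
  f' \in @lcc_pred arr K -> convolution gpd f f' \in @lcc_pred arr K.
Proof.
move=> lf lf'; rewrite convolutionE //; apply: fun_of_skew_mem.
by apply: skew_mul_mem => //; exact: skew_of_fun_mem.
Qed.

End SkewGroupoid.

(* Compactness of [X] gives both algebras their unit, hence the argument [cX]. *)
Definition partial_skew_ring (K : fieldType) (G : groupType) (X : topologicalType)
  (theta : partial_action G X) (cX : compact [set: X]) : Type := skew K theta.

Definition groupoid_algebra (K : fieldType) (G : groupType) (X : topologicalType)
  (theta : partial_action G X) (cX : compact [set: X]) : Type :=
  lcc (arrow theta) K.

Section PartialSkewRing.
Variables (K : fieldType) (G : groupType) (X : topologicalType).
Variables (theta : partial_action G X) (cX : compact [set: X]).
Local Notation psr := (partial_skew_ring K theta cX).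

HB.instance Definition _ := GRing.Lmodule.copy psr (skew K theta).

Definition psr_one : psr := Skew (skew_one_mem K theta cX).
Definition psr_mul (F F' : psr) : psr :=
  Skew (skew_mul_mem cX (skew_mem F) (skew_mem F')).

Lemma psr_mul_fun (F F' : psr) :
  skew_fun (psr_mul F F') = skew_mul theta (skew_fun F) (skew_fun F').
Proof. by []. Qed.

Lemma psr_mulA : associative psr_mul.
Proof.
move=> F1 F2 F3; apply: skew_inj; apply: skew_mulA; rewrite ?skew_mem //.
- exact: (skew_mul_mem cX (skew_mem F1) (skew_mem F2)).
- exact: (skew_mul_mem cX (skew_mem F2) (skew_mem F3)).
Qed.
Lemma psr_mul1 : left_id psr_one psr_mul.
Proof. by move=> F; apply: skew_inj; exact: (skew_mul1 cX (skew_mem F)). Qed.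
Lemma psr_mulr1 : right_id psr_one psr_mul.
Proof. by move=> F; apply: skew_inj; exact: (skew_mulr1 (skew_mem F)). Qed.

Lemma psr_addE (F F' : psr) :
  skew_fun (F + F' : psr) = skew_fun F + skew_fun F'.
Proof. exact: skew_funD. Qed.
Lemma psr_scaleE a (F : psr) : skew_fun (a *: F : psr) = a *: skew_fun F.
Proof. exact: skew_funZ. Qed.

Lemma psr_mulDl : left_distributive psr_mul +%R.
Proof.
move=> F1 F2 F3; apply: skew_inj; rewrite psr_addE !psr_mul_fun psr_addE.
exact: (skew_mulDl _ (skew_mem F1) (skew_mem F2)).
Qed.
Lemma psr_mulDr : right_distributive psr_mul +%R.
Proof.
move=> F1 F2 F3; apply: skew_inj; rewrite psr_addE !psr_mul_fun psr_addE.
exact: (skew_mulDr _ _ (skew_mem F1)).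
Qed.

HB.instance Definition _ := GRing.Zmodule_isPzRing.Build psr
  psr_mulA psr_mul1 psr_mulr1 psr_mulDl psr_mulDr.

Lemma psr_mulE (F F' : psr) :
  skew_fun (F * F' : psr) = skew_mul theta (skew_fun F) (skew_fun F').
Proof. by []. Qed.
Lemma psr_scaleAl (a : K) (F F' : psr) : a *: (F * F') = (a *: F) * F'.
Proof.
apply: skew_inj; rewrite psr_scaleE !psr_mulE psr_scaleE.
by rewrite (skew_mulZl _ _ (skew_mem F)).
Qed.
Lemma psr_scaleAr (a : K) (F F' : psr) : a *: (F * F') = F * (a *: F').
Proof.
apply: skew_inj; rewrite psr_scaleE !psr_mulE psr_scaleE.
by rewrite (skew_mulZr _ _ (skew_mem F)).
Qed.

End PartialSkewRing.

Section GroupoidAlgebra.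
Variables (K : fieldType) (G : groupType) (X : topologicalType).
Variables (theta : partial_action G X) (cX : compact [set: X]).
Local Notation ga := (groupoid_algebra K theta cX).
Local Notation psr := (partial_skew_ring K theta cX).

HB.instance Definition _ := GRing.Lmodule.copy ga (lcc (arrow theta) K).

(* The unit is the indicator function of the space of units {1} x X. *)
Definition ga_one_fun : arrow theta -> K^o := fun a => (arr_elt a == 1%g)%:R.

Lemma ga_one_funE : ga_one_fun = fun_of_skew (@skew_one K G X).
Proof.
by apply/funext=> a; rewrite /ga_one_fun /fun_of_skew /skew_one; case: eqP.
Qed.

Lemma ga_one_mem : ga_one_fun \in @lcc_pred (arrow theta) K.
Proof. by rewrite ga_one_funE; apply/fun_of_skew_mem/skew_one_mem. Qed.

Definition ga_one : ga := Lcc ga_one_mem.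
Definition ga_mul (f f' : ga) : ga :=
  Lcc (@convolution_mem K G X theta cX f f' (lcc_mem f) (lcc_mem f')).

Definition ga_of_psr (F : psr) : ga := Lcc (fun_of_skew_mem cX (skew_mem F)).
Definition psr_of_ga (f : ga) : psr := Skew (skew_of_fun_mem cX (lcc_mem f)).

Lemma ga_of_psrK : cancel ga_of_psr psr_of_ga.
Proof. by move=> F; apply/val_inj/fun_of_skewK/skew_mem. Qed.
Lemma psr_of_gaK : cancel psr_of_ga ga_of_psr.
Proof. by move=> f; apply/val_inj/skew_of_funK. Qed.

Lemma ga_of_psrM F F' : ga_of_psr (F * F') = ga_mul (ga_of_psr F) (ga_of_psr F').
Proof.
apply: lcc_inj; rewrite -[LHS]/(fun_of_skew (skew_fun (F * F'))) psr_mulE.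
rewrite -[RHS]/(@convolution K _ _ (transformation_groupoid theta) (fun_of_skew (skew_fun F)) (fun_of_skew (skew_fun F'))).
rewrite (@convolutionE K G X theta cX _ _ (fun_of_skew_mem cX (skew_mem F))).
by rewrite (fun_of_skewK (skew_mem F)) (fun_of_skewK (skew_mem F')).
Qed.

Lemma ga_of_psr1 : ga_of_psr 1 = ga_one.
Proof. by apply: lcc_inj; rewrite -[RHS]/ga_one_fun ga_one_funE. Qed.

Lemma ga_addE (f f' : ga) : lcc_fun (f + f' : ga) = lcc_fun f + lcc_fun f'.
Proof. exact: lcc_funD. Qed.
Lemma ga_scaleE a (f : ga) : lcc_fun (a *: f : ga) = a *: lcc_fun f.
Proof. exact: lcc_funZ. Qed.

Lemma ga_of_psrE F : lcc_fun (ga_of_psr F) = fun_of_skew (skew_fun F).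
Proof. by []. Qed.

Lemma ga_of_psrD F F' : ga_of_psr (F + F') = ga_of_psr F + ga_of_psr F'.
Proof. by apply: lcc_inj; rewrite ga_addE !ga_of_psrE psr_addE. Qed.

Lemma ga_of_psrZ a F : ga_of_psr (a *: F) = a *: ga_of_psr F.
Proof. by apply: lcc_inj; rewrite ga_scaleE !ga_of_psrE psr_scaleE. Qed.

Lemma ga_mulA : associative ga_mul.
Proof.
move=> f1 f2 f3; rewrite -[f1]psr_of_gaK -[f2]psr_of_gaK -[f3]psr_of_gaK.
by rewrite -!ga_of_psrM mulrA.
Qed.
Lemma ga_mul1 : left_id ga_one ga_mul.
Proof. by move=> f; rewrite -[f]psr_of_gaK -ga_of_psr1 -ga_of_psrM mul1r. Qed.
Lemma ga_mulr1 : right_id ga_one ga_mul.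
Proof. by move=> f; rewrite -[f]psr_of_gaK -ga_of_psr1 -ga_of_psrM mulr1. Qed.
Lemma ga_mulDl : left_distributive ga_mul +%R.
Proof.
move=> f1 f2 f3; rewrite -[f1]psr_of_gaK -[f2]psr_of_gaK -[f3]psr_of_gaK.
by rewrite -ga_of_psrD -!ga_of_psrM -ga_of_psrD mulrDl.
Qed.
Lemma ga_mulDr : right_distributive ga_mul +%R.
Proof.
move=> f1 f2 f3; rewrite -[f1]psr_of_gaK -[f2]psr_of_gaK -[f3]psr_of_gaK.
by rewrite -ga_of_psrD -!ga_of_psrM -ga_of_psrD mulrDr.
Qed.

HB.instance Definition _ := GRing.Zmodule_isPzRing.Build ga
  ga_mulA ga_mul1 ga_mulr1 ga_mulDl ga_mulDr.

Lemma ga_scaleAl (a : K) (f f' : ga) : a *: (f * f') = (a *: f) * f'.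
Proof.
rewrite -[f]psr_of_gaK -[f']psr_of_gaK -ga_of_psrZ.
by rewrite -[_ * _]ga_of_psrM -[RHS]ga_of_psrM -ga_of_psrZ psr_scaleAl.
Qed.
Lemma ga_scaleAr (a : K) (f f' : ga) : a *: (f * f') = f * (a *: f').
Proof.
rewrite -[f]psr_of_gaK -[f']psr_of_gaK -ga_of_psrZ.
by rewrite -[_ * _]ga_of_psrM -[RHS]ga_of_psrM -ga_of_psrZ psr_scaleAr.
Qed.

End GroupoidAlgebra.

Section GlobalDimension.
Variable R : pzRingType.

Definition projective (P : lmodType R) : Prop :=
  forall (M N : lmodType R) (p : {linear M -> N}) (f : {linear P -> N}),
    (forall y, exists x, p x = y) ->
    exists h : {linear P -> M}, forall x, p (h x) = f x.

Record projective_resolution (M : lmodType R) := ProjectiveResolution {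
  res_mod : nat -> lmodType R;
  res_diff : forall i, {linear res_mod i.+1 -> res_mod i};
  res_aug : {linear res_mod 0 -> M};
  res_projective : forall i, projective (res_mod i);
  res_aug_surj : forall y, exists x, res_aug x = y;
  res_exact0 : forall x, res_aug x = 0 <-> exists y, res_diff 0 y = x;
  res_exact : forall i x,
    res_diff i x = 0 <-> exists y, res_diff i.+1 y = x }.

Definition projective_dimension_le (M : lmodType R) (n : nat) : Prop :=
  exists P : projective_resolution M,
    forall i, (n < i)%N -> forall x : res_mod P i, x = 0.

(* The supremum of the projective dimensions of all left modules is at most [n]. *)
Definition global_dimension_le (n : nat) : Prop :=
  forall M : lmodType R, projective_dimension_le M n.

End GlobalDimension.

(* Main.v *)
(* Let R be the algebra, C = KX its degree-one part and d_g = 1_{X_g} delta_g. Since X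
   has only countably many clopen subsets, every ideal of C is generated by a
   sequence of orthogonal idempotents, so C is hereditary and the kernel L of a
   free cover of an R-module is projective over C. If Q -> L is a free cover
   over R, a map f from its kernel to N corresponds to a derivation
   b : R -> Hom_Z(L, N) vanishing on C, and lifting f along a surjection M -> N
   amounts to lifting b to a derivation into Hom_Z(L, M). By semi-saturation
   d_w is the product of the d_x over the letters x of the reduced word w, so
   such a derivation is freely prescribed on the generators d_a, where the
   C-projectivity of L provides the lifts. Hence the second syzygy of every
   R-module is projective. *)
From HB Require Import structures.
Require Import Defs.
From mathcomp Require Import all_boot all_order all_algebra.
From mathcomp Require Import all_classical all_reals all_analysis.

Set Implicit Arguments.
Unset Strict Implicit.
Unset Printing Implicit Defensive.

Import GRing.Theory.

Local Open Scope classical_set_scope.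
Local Open Scope ring_scope.

(** * Finite sums over index types *)

Lemma finsum_seq (I : choiceType) (V : nmodType) (phi : I -> V) (r : seq I) : uniq r ->
  (forall i, i \notin r -> phi i = 0) ->
  \sum_(i \in [set: I]) phi i = \sum_(i <- r) phi i.
Proof.
move=> ur hr; rewrite (fsbigE r) // => [|i _]; last exact: hr.
by apply: eq_bigl => i; rewrite in_setT.
Qed.

Section FiniteSums.
Variables (I : choiceType) (V : nmodType).

(** A list covering the support, possibly redundantly: covers of two families concatenate, and
    [undup] makes one fit for [finsum_seq]. *)
Definition finitely_supported (phi : I -> V) : Prop :=
  exists r : seq I, forall i, i \notin r -> phi i = 0.

Lemma finsum_eq1 (phi : I -> V) j : (forall i, i != j -> phi i = 0) ->
  \sum_(i \in [set: I]) phi i = phi j.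
Proof.
move=> hj; rewrite (@finsum_seq _ _ _ [:: j]) // ?big_seq1 // => i.
by rewrite inE; exact: hj.
Qed.

Lemma finsum_eq0 (phi : I -> V) : (forall i, phi i = 0) ->
  \sum_(i \in [set: I]) phi i = 0.
Proof. by move=> h; rewrite (@finsum_seq _ _ _ [::]) ?big_nil. Qed.

Lemma finsumD (phi psi : I -> V) :
  finitely_supported phi -> finitely_supported psi ->
  \sum_(i \in [set: I]) (phi i + psi i) =
  \sum_(i \in [set: I]) phi i + \sum_(i \in [set: I]) psi i.
Proof.
move=> [r hr] [s hs]; pose q := undup (r ++ s).
have uq : uniq q by exact: undup_uniq.
have hq i : i \notin q -> (i \notin r) && (i \notin s).
  by rewrite mem_undup mem_cat negb_or.
rewrite !(@finsum_seq _ _ _ q) ?big_split // => i /hq/andP[ir is_].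
- exact: hs.
- exact: hr.
- by rewrite hr // hs // addr0.
Qed.

Lemma finsum_morph (W : nmodType) (f : V -> W) (phi : I -> V) :
  f 0 = 0 -> {morph f : x y / x + y} -> finitely_supported phi ->
  f (\sum_(i \in [set: I]) phi i) = \sum_(i \in [set: I]) f (phi i).
Proof.
move=> f0 fD [r hr].
have hr' i : i \notin undup r -> phi i = 0 by rewrite mem_undup; exact: hr.
rewrite (finsum_seq (undup_uniq r) hr') (@finsum_seq _ W _ _ (undup_uniq r)).
  exact: (big_morph f fD f0).
by move=> i /hr' ->.
Qed.

End FiniteSums.

Lemma finsum_eq (I : choiceType) (V : nmodType) (phi psi : I -> V) :
  phi =1 psi -> \sum_(i \in [set: I]) phi i = \sum_(i \in [set: I]) psi i.
Proof. by move=> /funext ->. Qed.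

(** * Free modules and kernels *)

Section Modules.
Variable R : pzRingType.

(** Bundles maps whose linearity is proved only in the course of an argument, such as maps built
    from chosen preimages. *)
Lemma linear_ofP (L M : lmodType R) (h : L -> M) : linear h ->
  exists h' : {linear L -> M}, h' =1 h.
Proof.
move=> lh; pose m := GRing.isLinear.Build R L M *:%R h lh.
by exists (HB.pack_for {linear L -> M} h m).
Qed.

Section FreeModule.
Variable I : choiceType.

Definition finitely_supported_pred : {pred I -> R^o} :=
  fun phi => `[< finitely_supported phi >].

Lemma finitely_supported_submod : GRing.submod_closed finitely_supported_pred.
Proof.
split=> [|a f g /asboolP[r hr] /asboolP[s hs]]; apply/asboolP; first by exists [::].
exists (r ++ s) => i; rewrite mem_cat negb_or => /andP[/hr fi /hs gi].
by rewrite -[LHS]/(a *: f i + g i) fi gi scaler0 addr0.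
Qed.

HB.instance Definition _ := GRing.isSubmodClosed.Build R
  (I -> R^o) finitely_supported_pred finitely_supported_submod.

Record free_module := FreeModule {
  free_fun :> I -> R^o; free_mem : free_fun \in finitely_supported_pred }.

HB.instance Definition _ := [isSub for free_fun].
HB.instance Definition _ := [Choice of free_module by <:].
HB.instance Definition _ := [SubChoice_isSubLmodule of free_module by <:].

Lemma free_finsupp (x : free_module) : finitely_supported (x : I -> R^o).
Proof. exact/asboolP/free_mem. Qed.

Lemma free_funD (x y : free_module) i : (x + y) i = x i + y i :> R.
Proof. by []. Qed.

Lemma free_funZ (r : R) (x : free_module) i : (r *: x) i = r * x i :> R.
Proof. by []. Qed.

Lemma free_basis_mem j :
  (fun i => (i == j)%:R : R^o) \in finitely_supported_pred.
Proof.
by apply/asboolP; exists [:: j] => i; rewrite inE => /negbTE ->.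
Qed.

Definition free_basis j : free_module := FreeModule (free_basis_mem j).

Definition free_lift (L : lmodType R) (t : I -> L) (x : free_module) : L :=
  \sum_(i \in [set: I]) (x i : R) *: t i.

Lemma free_lift_finsupp (L : lmodType R) (t : I -> L) (x : free_module) :
  finitely_supported (fun i => (x i : R) *: t i).
Proof. by have [r hr] := free_finsupp x; exists r => i /hr ->; rewrite scale0r. Qed.

Lemma free_lift_linear (L : lmodType R) (t : I -> L) : linear (free_lift t).
Proof.
move=> a x y; rewrite /free_lift (@finsum_morph _ _ _ ( *:%R a)) ?scaler0 //.
- rewrite -finsumD; last 1 first.
  + exact: free_lift_finsupp.
  + apply: finsum_eq => i; rewrite free_funD free_funZ.
    by rewrite scalerDl scalerA.
  have [r hr] := free_lift_finsupp t x.
  by exists r => i /hr ->; rewrite scaler0.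
- by move=> u v; rewrite scalerDr.
- exact: free_lift_finsupp.
Qed.

Lemma free_lift_basis (L : lmodType R) (t : I -> L) j :
  free_lift t (free_basis j) = t j.
Proof.
rewrite /free_lift (@finsum_eq1 _ _ _ j) /= ?eqxx ?scale1r // => i /negbTE ->.
exact: scale0r.
Qed.

Lemma free_lift_val (x : free_module) : free_lift free_basis x = x.
Proof.
apply/val_inj/funext => j /=.
rewrite /free_lift (@finsum_morph _ _ _ (fun y : free_module => y j : R)) //.
  rewrite (@finsum_eq1 _ _ _ j) => [|i ij].
    by rewrite -[LHS]/(x j * (j == j)%:R : R) eqxx mulr1.
  by rewrite -[LHS]/(x i * (j == i)%:R : R) eq_sym (negbTE ij) mulr0.
exact: free_lift_finsupp.
Qed.

Lemma linear_free (N : lmodType R) (f : {linear free_module -> N}) x :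
  f x = free_lift (f \o free_basis) x.
Proof.
rewrite -{1}[x]free_lift_val /free_lift (finsum_morph (f := f)) ?linear0 //.
- by apply: finsum_eq => i; rewrite linearZ.
- exact: linearD.
- exact: free_lift_finsupp.
Qed.

Lemma free_module_projective : projective free_module.
Proof.
move=> M N p f psurj.
have [t pt] := choice (fun i => psurj (f (free_basis i))).
have [h hE] := linear_ofP (free_lift_linear t).
exists h => x; rewrite hE linear_free /free_lift (finsum_morph (f := p)) ?linear0 //.
- by apply: finsum_eq => i; rewrite linearZ /= pt.
- exact: linearD.
- exact: free_lift_finsupp.
Qed.

End FreeModule.

Section Kernel.
Variables (L M : lmodType R) (f : {linear L -> M}).

Definition ker_pred : {pred L} := fun x => f x == 0.

Lemma ker_submod : GRing.submod_closed ker_pred.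
Proof.
split=> [|a x y /eqP fx /eqP fy]; apply/eqP; first exact: linear0.
by rewrite linearP fx fy scaler0 addr0.
Qed.

HB.instance Definition _ := GRing.isSubmodClosed.Build R L ker_pred ker_submod.

Record kernel_module := KernelModule {
  kernel_val : L; kernel_mem : kernel_val \in ker_pred }.

HB.instance Definition _ := [isSub for kernel_val].
HB.instance Definition _ := [Choice of kernel_module by <:].
HB.instance Definition _ := [SubChoice_isSubLmodule of kernel_module by <:].

Lemma kernel_valE (x : kernel_module) : f (kernel_val x) = 0.
Proof. exact/eqP/kernel_mem. Qed.

Lemma kernel_val_linear : linear kernel_val. Proof. by []. Qed.
HB.instance Definition _ := GRing.isLinear.Build R kernel_module L _ kernel_val
  kernel_val_linear.

End Kernel.
End Modules.

(* An abstract partial crossed product: [hcomp g] is the projection onto the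
   summand C_g delta_g and [gen g] is delta_g. The last field says that the
   degree-one part C is von Neumann regular with countably many supports. *)
Record crossed_grading (R : pzRingType) (G : groupType) := CrossedGrading {
  hcomp : G -> R -> R;
  gen : G -> R;
  hcompD : forall g, {morph hcomp g : r s / r + s};
  hcomp_finsupp : forall r, finitely_supported (hcomp ^~ r);
  hcomp_sum : forall r, \sum_(g \in [set: G]) hcomp g r = r;
  hcomp_comp : forall g h r, hcomp g (hcomp h r) = if g == h then hcomp h r else 0;
  hcompM : forall g h r s,
    hcomp (g * h)%g (hcomp g r * hcomp h s) = hcomp g r * hcomp h s;
  hcomp_gen : forall g, hcomp g (gen g) = gen g;
  gen1 : gen 1%g = 1;
  hcomp1C : forall r s, hcomp 1%g r * hcomp 1%g s = hcomp 1%g s * hcomp 1%g r;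
  hcomp_genVK : forall g r, hcomp g r * gen g^-1%g * gen g = hcomp g r;
  supports : exists v : nat -> R,
    (forall n, hcomp 1%g (v n) = v n /\ v n * v n = v n) /\
    forall c, hcomp 1%g c = c -> exists n c',
      [/\ hcomp 1%g c' = c', v n = c' * c & c * v n = c] }.

(** * Graded calculus in an abstract partial crossed product *)

Section Crossed.
Variables (R : pzRingType) (G : groupType) (cg : crossed_grading R G).
Local Notation pr := (hcomp cg).
Local Notation d := (gen cg).

Definition homog (g : G) (r : R) : Prop := pr g r = r.
Local Notation base c := (homog 1%g c).

Lemma hcomp0 g : pr g 0 = 0.
Proof. by apply: (addIr (pr g 0)); rewrite -hcompD !add0r. Qed.

Lemma homog_comp g r : homog g (pr g r).
Proof. by rewrite /homog hcomp_comp eqxx. Qed.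

Lemma hcomp_homog g h r : homog h r -> pr g r = if g == h then r else 0.
Proof. by move=> hr; rewrite -{1}hr hcomp_comp hr. Qed.

Lemma homogM g h r s : homog g r -> homog h s -> homog (g * h)%g (r * s).
Proof. by rewrite /homog => <- <-; rewrite hcompM. Qed.

Lemma homogMV g r s : homog g r -> homog g^-1%g s -> base (r * s).
Proof. by rewrite -(mulgV g); exact: homogM. Qed.

Lemma homogVM g r s : homog g^-1%g r -> homog g s -> base (r * s).
Proof. by rewrite -(mulVg g); exact: homogM. Qed.

Lemma homog_gen g : homog g (d g). Proof. exact: hcomp_gen. Qed.

Lemma homogD g r s : homog g r -> homog g s -> homog g (r + s).
Proof. by move=> hr hs; rewrite /homog hcompD hr hs. Qed.

Lemma homogN g r : homog g r -> homog g (- r).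
Proof.
by move=> hr; apply: (addrI (pr g r)); rewrite -hcompD hr !subrr hcomp0.
Qed.

Lemma homog0 g : homog g 0. Proof. exact: hcomp0. Qed.

Lemma base1 : base 1. Proof. by rewrite -(gen1 cg); exact: homog_gen. Qed.

Lemma baseM r s : base r -> base s -> base (r * s).
Proof. by rewrite -{3}[1%g]mulg1; exact: homogM. Qed.

Lemma baseC r s : base r -> base s -> r * s = s * r.
Proof. by rewrite /homog => <- <-; rewrite hcomp1C. Qed.

Lemma homog_baseM g c r : base c -> homog g r -> homog g (c * r).
Proof. by rewrite -{2}[g]mul1g; exact: homogM. Qed.

Lemma homog_Mbase g c r : base c -> homog g r -> homog g (r * c).
Proof. by move=> hc hr; rewrite -[g]mulg1; exact: homogM. Qed.

Lemma homog_genVK g r : homog g r -> r * d g^-1%g * d g = r.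
Proof. by rewrite /homog => <-; rewrite hcomp_genVK. Qed.

Lemma genKV g : d g * d g^-1%g * d g = d g.
Proof. exact/homog_genVK/homog_gen. Qed.

Lemma base_gen_genV g : base (d g * d g^-1%g).
Proof. by apply: (@homogMV g); exact: homog_gen. Qed.

Lemma base_genV_gen g : base (d g^-1%g * d g).
Proof. by apply: (@homogVM g); exact: homog_gen. Qed.

(** The structure only provides the right unit [d g^-1 * d g] in degree [g]. With [r] written as
    [(r * d g^-1) * d g], the idempotent [d g * d g^-1] commutes past the first factor, which lies
    in C. *)
Lemma gen_genVK g r : homog g r -> d g * d g^-1%g * r = r.
Proof.
move=> hr; have hc : base (r * d g^-1%g).
  by apply: (@homogMV g) => //; exact: homog_gen.
rewrite -(homog_genVK hr) mulrA (baseC (base_gen_genV g) hc) -mulrA genKV.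
by rewrite homog_genVK.
Qed.

(** Left multiplication by [c] preserves every degree, as seen on the homogeneous components of
    [r]. *)
Lemma hcomp_baseM g c r : base c -> pr g (c * r) = c * pr g r.
Proof.
move=> hc; have fs := hcomp_finsupp cg r.
have mD : {morph ( *%R c) : x y / x + y} by move=> x y; rewrite mulrDr.
rewrite -{1}(hcomp_sum cg r) (finsum_morph (mulr0 c) mD fs).
rewrite (finsum_morph (hcomp0 g) (hcompD cg g)); last first.
  by have [s hs] := fs; exists s => i /hs ->; rewrite mulr0.
rewrite (@finsum_eq1 _ _ _ g) => [|h hg].
  by apply: homog_baseM => //; exact: homog_comp.
rewrite (@hcomp_homog g h); first by rewrite eq_sym (negbTE hg).
by apply: homog_baseM => //; exact: homog_comp.
Qed.

Definition base_ideal (I : set R) : Prop :=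
  [/\ I `<=` [set c | base c], forall x y, I x -> I y -> I (x + y) &
      forall c x, base c -> I x -> I (c * x)].

(** The support idempotent [v N] of an element [c] of [I] is a multiple of [c], so it lies in [I].
    Hence the members of [v] inside [I] generate it, and removing from each what the earlier ones
    cover gives [u]. *)
Lemma base_ideal_idempotents (I : set R) : base_ideal I -> I 0 ->
  exists u : nat -> R, [/\ forall n, I (u n), forall n, u n * u n = u n &
    forall c, I c -> finitely_supported (fun n => c * u n) /\
      \sum_(n \in [set: nat]) c * u n = c].
Proof.
move=> [Ib ID IM] I0; have [v [vi vs]] := supports cg.
pose v' n := if `[< I (v n) >] then v n else 0.
have Iv n : I (v' n) by rewrite /v'; case: asboolP.
have bv n : base (v' n) by exact: Ib.
have v2 n : v' n * v' n = v' n.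
  by rewrite /v'; case: asboolP => _; rewrite ?mulr0 //; case: (vi n).
(* [w n] is the product of the [1 - v' m] with m < n: the complement of the union of the first [n]
   idempotents. *)
pose w := fix w n := if n is m.+1 then w m * (1 - v' m) else 1.
have wS n : w n.+1 = w n * (1 - v' n) by [].
have b1v n : base (1 - v' n) by apply: homogD; [exact: base1 | exact: homogN].
have bw n : base (w n).
  by elim: n => [|n IH]; [exact: base1 | rewrite wS; exact: baseM].
have v12 n : (1 - v' n) * (1 - v' n) = 1 - v' n.
  by rewrite mulrBr mulr1 mulrBl mul1r v2 subrr subr0.
have w2 n : w n * w n = w n.
  elim: n => [|n IH]; first exact: mulr1.
  rewrite wS -mulrA (mulrA (1 - v' n)) -(baseC (bw n) (b1v n)).
  by rewrite -(mulrA (w n) (1 - v' n)) v12 mulrA IH.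
have wle m n : (m <= n)%N -> w m * w n = w n.
  elim: n => [|n IH]; first by rewrite leqn0 => /eqP ->; exact: w2.
  rewrite leq_eqVlt => /predU1P[->|]; first exact: w2.
  by rewrite ltnS => /IH e; rewrite wS mulrA e.
pose u n := w n * v' n.
have uE n : u n = w n - w n.+1 by rewrite /u wS mulrBr mulr1 subKr.
exists u; split=> [n|n|c Ic].
- exact: IM.
- rewrite {2}uE mulrBr uE !mulrBl !w2 (baseC (bw n.+1)) //.
  by rewrite wle // subrr subr0.
- have bc : base c := Ib _ Ic.
  have [N [c' [bc' vN cv]]] := vs c bc.
  have IN : I (v N) by rewrite vN; exact: IM.
  have v'N : v' N = v N by rewrite /v'; case: asboolP.
  (* [c] is fixed by [v N], so the factor [1 - v' N] of [w n] kills it. *)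
  have cw n : (N < n)%N -> c * w n = 0.
    move=> Nn; rewrite -(wle _ _ Nn) mulrA wS v'N.
    by rewrite (baseC (bw N)) ?mulrA ?mulrBr ?mulr1 ?cv ?subrr ?mul0r // -v'N.
  have cu n : n \notin iota 0 N.+1 -> c * u n = 0.
    rewrite mem_iota /= add0n -leqNgt => Nn.
    by rewrite uE mulrBr !cw ?subrr // ltnW.
  split; first by exists (iota 0 N.+1).
  rewrite (finsum_seq (iota_uniq 0 N.+1) cu) -mulr_sumr.
  suff -> : \sum_(n <- iota 0 N.+1) u n = 1 - w N.+1.
    by rewrite mulrBr cw // mulr1 subr0.
  rewrite -[iota _ _]/(index_iota 0 N.+1) (@GRing.telescope_sumr_eq _ _ _ (fun n => - w n)) //.
    by rewrite opprK addrC.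
  by move=> n _; rewrite uE opprK addrC.
Qed.

(** Restricted to [P] because the partial maps of the Zorn argument below are total functions with
    relevant values only on a submodule. *)
Definition base_linear_on (L M : lmodType R) (P : set L) (f : L -> M) : Prop :=
  (forall x y, P x -> P y -> f (x + y) = f x + f y) /\
  (forall c x, base c -> P x -> f (c *: x) = c *: f x).

Definition base_linear (L M : lmodType R) (f : L -> M) : Prop :=
  base_linear_on setT f.

(** Projectivity over C, tested on R-linear surjections of R-modules: the C-linear maps to be lifted
    later all take values in R-modules. *)
Definition base_projective (L : lmodType R) : Prop :=
  forall (M N : lmodType R) (p : {linear M -> N}) (f : L -> N),
    (forall y, exists x, p x = y) -> base_linear f ->
    exists h : L -> M, base_linear h /\ forall x, p (h x) = f x.

Section BaseLinear.
Variables (L M : lmodType R) (f : L -> M).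
Hypothesis fl : base_linear f.

Lemma base_linearD x y : f (x + y) = f x + f y. Proof. by case: fl => + _; apply. Qed.

Lemma base_linearZ c x : base c -> f (c *: x) = c *: f x.
Proof. by case: fl => _ + bc; apply. Qed.

Lemma base_linear0 : f 0 = 0.
Proof. by rewrite -(scale0r 0) base_linearZ ?scale0r //; exact: homog0. Qed.

Lemma base_linearN x : f (- x) = - f x.
Proof. by apply: (addrI (f x)); rewrite -base_linearD !subrr base_linear0. Qed.

Lemma base_linearB x y : f (x - y) = f x - f y.
Proof. by rewrite base_linearD base_linearN. Qed.

End BaseLinear.

End Crossed.

(** * Projectivity over the degree-one part by Kaplansky's argument *)

Section Hereditary.
Variables (R : pzRingType) (G : groupType) (cg : crossed_grading R G).
Variables (L : lmodType R) (I : choiceType) (coord : I -> L -> R).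
Hypothesis coord_base : forall i x, homog cg 1%g (coord i x).
Hypothesis coordD : forall i x y, coord i (x + y) = coord i x + coord i y.
Hypothesis coordZ : forall i c x, homog cg 1%g c -> coord i (c *: x) = c * coord i x.
Hypothesis coord_finsupp : forall x, finitely_supported (coord ^~ x).
Hypothesis coord_inj : forall x, (forall i, coord i x = 0) -> x = 0.

(** The coordinates embed L into the free C-module on [I]. These submodules filter L as in
    Kaplansky's theorem on hereditary rings, with subsets of [I] in place of a well-ordering. *)
Definition supported_on (J : set I) : set L :=
  [set x | forall i, ~ J i -> coord i x = 0].

Lemma supported_onD J x y :
  supported_on J x -> supported_on J y -> supported_on J (x + y).
Proof. by move=> hx hy i nJ; rewrite coordD hx // hy // addr0. Qed.

Lemma supported_onZ J c x : homog cg 1%g c ->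
  supported_on J x -> supported_on J (c *: x).
Proof. by move=> hc hx i nJ; rewrite coordZ // hx // mulr0. Qed.

Lemma supported_on0 J : supported_on J 0.
Proof.
by move=> i nJ; rewrite -(scale0r 0) coordZ ?mul0r //; exact: homog0.
Qed.

Lemma supported_onS (J J' : set I) : J `<=` J' ->
  supported_on J `<=` supported_on J'.
Proof. by move=> JJ' x hx i nJ'; apply: hx => /JJ'. Qed.

Lemma coord_sum i (J : choiceType) (t : J -> L) : finitely_supported t ->
  coord i (\sum_(j \in [set: J]) t j) = \sum_(j \in [set: J]) coord i (t j).
Proof.
move=> ft; apply: (finsum_morph (f := coord i)) ft; last exact: coordD.
by rewrite -(scale0r 0) coordZ ?mul0r //; exact: homog0.
Qed.

Section Lift.
Variables (M N : lmodType R) (p : {linear M -> N}) (f : L -> N).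
Hypothesis psurj : forall y, exists x, p x = y.
Hypothesis fl : base_linear cg f.

Definition partial_lift (Jh : set I * (L -> M)) : Prop :=
  base_linear_on cg (supported_on Jh.1) Jh.2 /\
  forall x, supported_on Jh.1 x -> p (Jh.2 x) = f x.

Definition lift_extends (s t : set I * (L -> M)) : Prop :=
  s.1 `<=` t.1 /\ forall x, supported_on s.1 x -> s.2 x = t.2 x.

Lemma lift_extends_refl s : lift_extends s s. Proof. by split. Qed.

Lemma lift_extends_trans r s t :
  lift_extends r s -> lift_extends s t -> lift_extends r t.
Proof.
move=> [rs ers] [st est]; split; first exact: subset_trans st.
by move=> x rx; rewrite ers // est //; exact: supported_onS rx.
Qed.

(* The new coordinates fill an ideal of C, generated by orthogonal idempotents
   [u n]. Preimages [w n] of these split off the part already lifted. *)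
Lemma partial_lift_step J h i : partial_lift (J, h) -> ~ J i ->
  exists h', partial_lift (J `|` [set i], h') /\
    lift_extends (J, h) (J `|` [set i], h').
Proof.
move=> [[hD hZ] ph] nJi; rewrite /= in hD hZ ph.
set J' := J `|` [set i].
pose A : set R := coord i @` supported_on J'.
have idA : base_ideal cg A.
  split=> [_ [x _ <-]|_ _ [x hx <-] [y hy <-]|c _ hc [x hx <-]] /=.
  - exact: coord_base.
  - by exists (x + y); [exact: supported_onD | rewrite coordD].
  - by exists (c *: x); [exact: supported_onZ | rewrite coordZ].
have A0 : A 0.
  by exists 0; [exact: supported_on0 | apply: (addIr (coord i 0)); rewrite -coordD !add0r].
have [u [Au u2 Ac]] := base_ideal_idempotents idA A0.
have bA c : A c -> homog cg 1%g c by case: idA => + _ _; apply.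
have /choice[w hw] n : exists x, supported_on J' x /\ coord i x = u n.
  by have [x] := Au n; exists x.
have [m pm] := choice (fun n => psurj (f (w n))).
(* [T V t] is C-linear on [A]. For [t = w] it is a section of the coordinate [i], as [u n] is
   idempotent and [c] is the sum of the [c * u n]. *)
pose T (V : lmodType R) (t : nat -> V) c := \sum_(n \in [set: nat]) (c * u n) *: t n.
have fsT (V : lmodType R) (t : nat -> V) c : A c ->
    finitely_supported (fun n => (c * u n) *: t n : V).
  by move=> /Ac[[r hr] _]; exists r => n /hr ->; rewrite scale0r.
have TD (V : lmodType R) (t : nat -> V) c c' : A c -> A c' -> @T V t (c + c') = T V t c + T V t c'.
  move=> hc hc'; rewrite /T -finsumD; try exact: fsT.
  by apply: finsum_eq => n; rewrite mulrDl scalerDl.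
have TZ (V : lmodType R) (t : nat -> V) c c' : A c -> @T V t (c' * c) = c' *: T V t c.
  move=> hc; rewrite /T (finsum_morph (f := ( *:%R c'))) ?scaler0 //; last 2 first.
  - by move=> x y; rewrite scalerDr.
  - exact: fsT.
  by apply: finsum_eq => n; rewrite scalerA mulrA.
have T0 (V : lmodType R) (t : nat -> V) : @T V t 0 = 0.
  by apply: finsum_eq0 => n; rewrite mul0r scale0r.
have TJ c : A c -> supported_on J' (T L w c).
  move=> hc k nk; rewrite coord_sum; last exact: fsT.
  apply: finsum_eq0 => n; rewrite coordZ ?(proj1 (hw n)) ?mulr0 //.
  by apply: (@baseM _ _ cg); exact: bA.
have Ti c : A c -> coord i (T L w c) = c.
  move=> hc; rewrite coord_sum; last exact: fsT.
  rewrite -[RHS](proj2 (Ac _ hc)); apply: finsum_eq => n.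
  rewrite coordZ ?(proj2 (hw n)) -?mulrA ?u2 //.
  by apply: (@baseM _ _ cg); exact: bA.
have pT c : A c -> p (T M m c) = f (T L w c).
  move=> hc; rewrite /T (finsum_morph (f := p)) ?linear0 //; last 2 first.
  - exact: linearD.
  - exact: fsT.
  rewrite (finsum_morph (f := f)); last first.
  - exact: fsT.
  - exact: (base_linearD fl).
  - exact: (base_linear0 fl).
  apply: finsum_eq => n; rewrite linearZ /= pm (base_linearZ fl) //.
  by apply: (@baseM _ _ cg); exact: bA.
have AJ x : supported_on J' x -> A (coord i x) by exists x.
(* Subtracting the section removes the coordinate [i]: an element supported on [J'] splits into one
   supported on [J] and one determined by its coordinate in [A]. *)
pose q x := x - T L w (coord i x).
have TN x : supported_on J' x -> supported_on J' (- T L w (coord i x)).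
  move=> /AJ hx; rewrite -scaleN1r; apply: supported_onZ (TJ _ hx).
  by apply: homogN; exact: base1.
have qJ x : supported_on J' x -> supported_on J (q x).
  move=> hx k nJk; have [-> | ki] := eqVneq k i.
    apply: (addIr (coord i (T L w (coord i x)))).
    by rewrite -coordD /q subrK add0r Ti //; exact: AJ.
  apply: supported_onD (TN x hx) _ _ => //.
  by case=> // /eqP; rewrite (negbTE ki).
have qD x y : supported_on J' x -> supported_on J' y -> q (x + y) = q x + q y.
  by move=> hx hy; rewrite /q coordD (TD _ _ _ _ (AJ x hx) (AJ y hy)) opprD addrACA.
have qZ c x : homog cg 1%g c -> supported_on J' x -> q (c *: x) = c *: q x.
  by move=> hc hx; rewrite /q coordZ // (TZ _ _ _ _ (AJ x hx)) scalerBr.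
exists (fun x => h (q x) + T M m (coord i x)).
split; first split=> [|x /= hx].
- split=> [x y hx hy|c x hc hx] /=.
    rewrite qD // hD; [|exact: qJ|exact: qJ].
    by rewrite coordD (TD _ _ _ _ (AJ x hx) (AJ y hy)) addrACA.
  rewrite qZ // hZ //; last exact: qJ.
  by rewrite coordZ // (TZ _ _ _ _ (AJ x hx)) scalerDr.
- rewrite linearD ph; last exact: qJ.
  by rewrite (pT _ (AJ x hx)) (base_linearB fl) subrK.
- split=> [|x /= hx]; first exact: subsetUl.
  by rewrite /q hx // !T0 subr0 addr0.
Qed.

(** Zorn's lemma on partial lifts ordered by extension. By finite supports, each element supported
    on the union of a chain is supported on one member, so the union carries a partial lift; a
    maximal one misses no coordinate by [partial_lift_step]. *)
Lemma coord_lift : exists h, base_linear cg h /\ forall x, p (h x) = f x.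
Proof.
pose S := {Jh : set I * (L -> M) | partial_lift Jh}.
pose le : rel S := fun s t => `[< lift_extends (sval s) (sval t) >].
have start : partial_lift (set0, fun=> 0).
  split=> [|x hx]; first by split=> [x y _ _|c x _ _] /=; rewrite ?addr0 ?scaler0.
  by rewrite linear0 (@coord_inj x) ?(base_linear0 fl) // => i; exact: hx.
have [|r s t /asboolP rs /asboolP st|A Atot|] := @ZL_preorder S (exist _ _ start) le.
- by move=> s; apply/asboolP; exact: lift_extends_refl.
- by apply/asboolP; exact: lift_extends_trans st.
- have [[s0 As0]|nA] := pselect (exists s, A s); last first.
    by exists (exist _ _ start) => s As; exfalso; apply: nA; exists s.
  pose J := \bigcup_(s in A) (sval s).1.
  have cover (r : seq I) : exists2 s, A s & forall i, i \in r -> J i -> (sval s).1 i.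
    elim: r => [|i r [s As hs]]; first by exists s0.
    have [[t At ti]|nJi] := pselect (J i); last first.
      by exists s => // k; rewrite inE => /predU1P[-> /nJi//|]; exact: hs.
    have [/asboolP[st _]|/asboolP[ts _]] := Atot _ _ As At.
      by exists t => // k; rewrite inE => /predU1P[->//|kr Jk]; apply: st; exact: hs.
    by exists s => // k; rewrite inE => /predU1P[-> _|]; [exact: ts | exact: hs].
  have cov x : supported_on J x -> exists2 s, A s & supported_on (sval s).1 x.
    move=> Jx; have [r hr] := coord_finsupp x; have [s As hs] := cover r.
    exists s => // i nsi; have [ir|/hr//] := boolP (i \in r).
    by apply: Jx => Ji; apply: nsi; exact: hs.
  have compat s t x : A s -> A t -> supported_on (sval s).1 x ->
      supported_on (sval t).1 x -> (sval s).2 x = (sval t).2 x.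
    by move=> As At sx tx; have [/asboolP[_ ->]|/asboolP[_ ->]] := Atot _ _ As At.
  (* Members of the chain agree where they overlap; 0 is a placeholder where no member applies. *)
  have /choice[h hE] x : exists y : M, forall s, A s ->
      supported_on (sval s).1 x -> y = (sval s).2 x.
    have [[s As sx]|nx] := pselect (exists2 s, A s & supported_on (sval s).1 x).
      by exists ((sval s).2 x) => t At tx; exact: compat.
    by exists 0 => s As sx; exfalso; apply: nx; exists s.
  have upper x y : supported_on J x -> supported_on J y ->
      exists s, [/\ A s, supported_on (sval s).1 x & supported_on (sval s).1 y].
    move=> /cov[s As sx] /cov[t At ty].
    have [/asboolP[st _]|/asboolP[ts _]] := Atot _ _ As At.
      by exists t; split=> //; exact: supported_onS sx.
    by exists s; split=> //; exact: supported_onS ty.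
  have good : partial_lift (J, h).
    split=> [|x /= /cov[s As sx]]; last by rewrite (hE _ _ As sx); case: (svalP s) => _ ->.
    split=> [x y|c x bc] /=.
      move=> Jx Jy; have [s [As sx sy]] := upper _ _ Jx Jy.
      rewrite !(hE _ s) //; last exact: supported_onD.
      by case: (svalP s) => -[-> ].
    move=> Jx; have [s As sx] := cov x Jx.
    rewrite !(hE _ s) //; last exact: supported_onZ.
    by case: (svalP s) => -[_ ->].
  exists (exist _ _ good) => s As; apply/asboolP; split=> [i si|x sx] /=.
    by exists s.
  by rewrite (hE _ s).
- move=> [[J h] Jh] maxJ.
  have JT i : J i.
    apply: contrapT => nJi; have [h' [good ext]] := partial_lift_step Jh nJi.
    (* [le] is only a preorder, so maximality says that the extension is also below, which forces
       [i] into [J]. *)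
    have /maxJ/asboolP[/= JJ _] : le (exist _ _ Jh) (exist _ _ good) by apply/asboolP.
    by apply: nJi; apply: JJ; right.
  have sT x : supported_on J x by move=> i /(_ (JT i)).
  case: Jh {maxJ} => -[/= hD hZ] ph; exists h; split; last by move=> x; exact: ph.
  by split=> [x y _ _|c x bc _]; [exact: hD | exact: hZ].
Qed.

End Lift.

Lemma coord_base_projective : base_projective cg L.
Proof. by move=> M N p f psurj fl; exact: coord_lift. Qed.

End Hereditary.

(* With Hom_Z(L, M) as R-bimodule, a derivation from R to it, uncurried. *)
Record derivation (R : pzRingType) (L M : lmodType R) (D : R -> L -> M) : Prop := {
  derDl : forall r s x, D (r + s) x = D r x + D s x;
  derDr : forall r x y, D r (x + y) = D r x + D r y;
  derM : forall r s x, D (r * s) x = D r (s *: x) + r *: D s x }.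

(** * Extensions twisted by a derivation *)

Section TwistedModule.
Variables (R : pzRingType) (L M : lmodType R) (D : R -> L -> M).
Hypothesis derD : derivation D.

Definition twisted of derivation D : Type := (L * M)%type.

HB.instance Definition _ := GRing.Zmodule.copy (twisted derD) (L * M)%type.

Definition twisted_scale (r : R) (x : twisted derD) : twisted derD :=
  (r *: x.1, r *: x.2 + D r x.1).

Lemma twisted_scaleA r s x :
  twisted_scale r (twisted_scale s x) = twisted_scale (r * s) x.
Proof.
rewrite /twisted_scale /= !scalerA (derM derD) scalerDr scalerA -addrA.
by congr (_, _ + _); rewrite addrC.
Qed.

Lemma twisted_scale1 : left_id 1 twisted_scale.
Proof.
move=> [x y]; rewrite /twisted_scale /= !scale1r.
(* The Leibniz rule for the product of 1 with itself gives D 1 = D 1 + D 1. *)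
suff -> : D 1 x = 0 by rewrite addr0.
apply: (addIr (D 1 x)); rewrite add0r -{3}[1]mulr1 (derM derD).
by rewrite !scale1r.
Qed.

Lemma twisted_scaleDr : right_distributive twisted_scale +%R.
Proof.
move=> r [x y] [x' y']; rewrite /twisted_scale; congr (_, _) => /=.
  exact: scalerDr.
by rewrite scalerDr (derDr derD) addrACA.
Qed.

Lemma twisted_scaleDl x : {morph twisted_scale^~ x : r s / r + s}.
Proof.
move=> r s; rewrite /twisted_scale; congr (_, _) => /=; first exact: scalerDl.
by rewrite scalerDl (derDl derD) addrACA.
Qed.

HB.instance Definition _ := GRing.Zmodule_isLmodule.Build R (twisted derD)
  twisted_scaleA twisted_scale1 twisted_scaleDr twisted_scaleDl.

Definition twisted_fst (x : twisted derD) : L := x.1.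

Lemma twisted_fst_linear : linear twisted_fst. Proof. by []. Qed.

(* A lift of [pi] to the extension L x M twisted by [D] amounts to [theta]. *)
Lemma projective_potential (Q : lmodType R) (pi : {linear Q -> L}) :
  projective Q -> exists theta : Q -> M,
    (forall x y, theta (x + y) = theta x + theta y) /\
    (forall r x, theta (r *: x) = r *: theta x + D r (pi x)).
Proof.
move=> projQ; have [q qE] := linear_ofP twisted_fst_linear.
have [|j jE] := projQ _ _ q pi.
  by move=> x; exists ((x, 0) : twisted derD); rewrite qE.
have j1 x : (j x).1 = pi x by rewrite -jE qE.
exists (fun x => (j x).2); split=> [x y|r x]; first by rewrite linearD.
by rewrite linearZ /= -j1.
Qed.

End TwistedModule.

(** * Projective kernels from lifted derivations *)

Section KernelProjective.
Variables (R : pzRingType) (G : groupType) (cg : crossed_grading R G).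
Variable L : lmodType R.
Hypothesis projL : base_projective cg L.

Definition derivations_lift : Prop :=
  forall (M N : lmodType R) (p : {linear M -> N}) (b : R -> L -> N),
    (forall y, exists x, p x = y) -> derivation b ->
    (forall c x, homog cg 1%g c -> b c x = 0) ->
    exists2 D : R -> L -> M, derivation D & forall r x, p (D r x) = b r x.

(** A C-linear section [sg] of [pi] gives a C-linear retraction [kr] of [Q] onto the kernel. Its
    composite with [f] fails to be R-linear by a derivation, which is lifted to [M] and integrated
    there to [theta]; what remains is an R-linear lifting problem on the projective [Q]. *)
Lemma kernel_projective (Q : lmodType R) (pi : {linear Q -> L}) :
  derivations_lift -> projective Q -> (forall y, exists x, pi x = y) ->
  projective (kernel_module pi).
Proof.
move=> lift projQ pisurj M N p f psurj.
have [|sg [sgl piK]] := projL (p := pi) (f := id) pisurj; first by [].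
have kerP x : x - sg (pi x) \in ker_pred pi.
  by apply/eqP; rewrite linearB piK subrr.
pose kr x := KernelModule (kerP x).
have krD x y : kr (x + y) = kr x + kr y.
  apply: val_inj; rewrite /= linearD (base_linearD sgl).
  by rewrite -[RHS]/(_ - _ + (_ - _)) opprD addrACA.
have bP r x : r *: sg x - sg (r *: x) \in ker_pred pi.
  by apply/eqP; rewrite linearB linearZ /= !piK subrr.
(* The defect of [sg] from R-linearity, that is, the inner derivation of [sg] in Hom_Z(L, Q); it
   vanishes for scalars in C. *)
pose bk r x := KernelModule (bP r x).
have krZ r x : kr (r *: x) = r *: kr x + bk r (pi x).
  apply: val_inj; rewrite /= linearZ -[RHS]/(r *: (_ - _) + (_ - _)) /=.
  by rewrite scalerBr addrA subrK.
have derb : derivation (fun r x => f (bk r x)).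
  split=> [r s x|r x y|r s x].
  - rewrite -linearD; congr (f _); apply: val_inj.
    rewrite -[RHS]/(_ - _ + (_ - _)) /= !scalerDl (base_linearD sgl).
    by rewrite opprD addrACA.
  - rewrite -linearD; congr (f _); apply: val_inj.
    rewrite -[RHS]/(_ - _ + (_ - _)) /= !(scalerDr, base_linearD sgl).
    by rewrite opprD addrACA.
  - rewrite -linearZ -linearD; congr (f _); apply: val_inj.
    rewrite -[RHS]/(_ - _ + _ *: (_ - _)) /= scalerBr !scalerA [RHS]addrC.
    by rewrite addrA subrK.
have b0 c x : homog cg 1%g c -> f (bk c x) = 0.
  move=> hc; rewrite (_ : bk c x = 0) ?linear0 //.
  by apply: val_inj; rewrite /= (base_linearZ sgl) // subrr.
have [D derD pD] := lift _ _ p _ psurj derb b0.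
have [theta [thD thZ]] := projective_potential derD pi projQ.
(* [p \o theta] and [f \o kr] have the same defect, so their difference is R-linear. *)
have om_lin : linear (fun x => p (theta x) - f (kr x)).
  move=> r x y; rewrite thD thZ krD krZ !linearD !linearZ /= pD.
  by rewrite scalerBr scalerN addrACA (addrACA (r *: _)) subrr addr0.
have [om omE] := linear_ofP om_lin.
have [om' om'E] := projQ _ _ p om psurj.
(* On the kernel of [pi] the defect [D r (pi x)] of [theta] vanishes. *)
have h_lin : linear (fun x : kernel_module pi =>
    theta (kernel_val x) - om' (kernel_val x)).
  have D0 r : D r 0 = 0.
    by apply: (addIr (D r 0)); rewrite -(derDr derD) !add0r.
  move=> r x y; rewrite -[kernel_val (r *: x + y)]/(r *: kernel_val x + kernel_val y).
  rewrite thD thZ kernel_valE D0 addr0 linearD linearZ /=.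
  by rewrite opprD addrACA scalerBr.
have [h hE] := linear_ofP h_lin.
exists h => x; rewrite hE linearB om'E omE opprB addrC subrK.
congr (f _); apply: val_inj; rewrite /= kernel_valE (base_linear0 sgl).
exact: subr0.
Qed.

End KernelProjective.

(** * Homogeneous elements and conjugation by generators *)

Section Homogeneous.
Variables (R : pzRingType) (G : groupType) (cg : crossed_grading R G).
Local Notation d := (gen cg).

Lemma homog_ind (P : R -> Prop) : P 0 ->
  (forall r s, P r -> P s -> P (r + s)) ->
  (forall g r, homog cg g r -> P r) -> forall r, P r.
Proof.
move=> P0 PD Ph r; rewrite -(hcomp_sum cg r); have [s hs] := hcomp_finsupp cg r.
have hs' g : g \notin undup s -> hcomp cg g r = 0 by rewrite mem_undup => /hs.
rewrite (finsum_seq (undup_uniq s) hs'); apply: (big_ind P) => // g _.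
by apply: (Ph g); exact: homog_comp.
Qed.

Lemma genV_base g c : homog cg 1%g c ->
  d g^-1%g * c = d g^-1%g * c * d g * d g^-1%g.
Proof.
move=> hc; have hr : homog cg g^-1%g (d g^-1%g * c).
  exact: (homog_Mbase hc (homog_gen _ _)).
by have := homog_genVK hr; rewrite invgK.
Qed.

Lemma conj_base g c : homog cg 1%g c -> homog cg 1%g (d g^-1%g * c * d g).
Proof.
move=> hc; apply: (@homogVM _ _ cg g); last exact: homog_gen.
exact: (homog_Mbase hc (homog_gen _ _)).
Qed.

Lemma gen_conj_base g c : homog cg 1%g c ->
  d g * (d g^-1%g * c * d g) = c * d g.
Proof.
move=> hc; rewrite !mulrA -mulrA gen_genVK //.
exact: (homog_baseM hc (homog_gen _ _)).
Qed.

(** A scalar [c] passes [d g^-1] as its conjugate, which [f] lets through and [d g] turns back into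
    [c]. *)
Lemma conj_base_linear (L M : lmodType R) (f : L -> M) g :
  base_linear cg f -> base_linear cg (fun x => d g *: f (d g^-1%g *: x)).
Proof.
move=> fl; split=> [x y _ _|c x hc _].
  by rewrite scalerDr (base_linearD fl) scalerDr.
rewrite scalerA (genV_base _ hc) -scalerA (base_linearZ fl); last exact: conj_base.
by rewrite scalerA gen_conj_base // -scalerA.
Qed.

End Homogeneous.

(** * Derivations prescribed on the letters of a free group *)

Section FreeGroupDerivation.
Variables (R : pzRingType) (A : choiceType).
Variable cg : crossed_grading R (free_group A).
Hypothesis gen_reduced : forall u v : free_group A,
  fg_length (u * v)%g = (fg_length u + fg_length v)%N ->
  gen cg (u * v)%g = gen cg u * gen cg v.

Definition fg_letter (x : letter A) : free_group A := @FreeGroup A [:: x] isT.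

Lemma fg_letterV x : (fg_letter x)^-1%g = fg_letter (linv x).
Proof. exact: val_inj. Qed.

Local Notation dl x := (gen cg (fg_letter x)).

Definition gen_word (w : seq (letter A)) : R := foldr (fun x r => dl x * r) 1 w.

(** Lengths add when the first letter of a reduced word is split off, so [gen_reduced] applies
    letter by letter. *)
Lemma gen_wordE (g : free_group A) : gen cg g = gen_word (fg_word g).
Proof.
case: g => w; elim: w => [|x w IHw] rw /=.
  by rewrite -(gen1 cg); congr (gen cg _); exact: val_inj.
have rw' : reduced w by exact: path_sorted rw.
rewrite -(IHw rw').
have e : FreeGroup rw = (fg_letter x * FreeGroup rw')%g.
  apply: val_inj; rewrite -[RHS]/(fg_push x w).
  by case: (w) rw => //= y s /andP[/negbTE ->].
by rewrite {1}e gen_reduced // -e.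
Qed.

Lemma letterVK x : dl (linv x) * dl x * dl (linv x) = dl (linv x).
Proof. by rewrite -fg_letterV -{2}[fg_letter x]invgK genKV. Qed.

Lemma letterK x : dl x * dl (linv x) * dl x = dl x.
Proof. by have := letterVK (linv x); rewrite linvK. Qed.

Section Words.
Variables (L M : lmodType R) (Dl : letter A -> L -> M).
Hypothesis Dl_linear : forall x, base_linear cg (Dl x).
(** [Dl x l] stands for D(d_x) applied to [dl (linv x) *: l]. The equation is then the Leibniz rule
    for [dl x * dl (linv x)], an element of C, on which D is to vanish. *)
Hypothesis DlV : forall x l, dl x *: Dl (linv x) l = - Dl x (dl x *: l).

(* [der_word w (d_w *: l)] is to be D(d_w) l, so the recursion is the Leibniz rule
   D(d_x d_w') l = D(d_x) (d_w' l) + d_x D(d_w') l. *)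
Fixpoint der_word (w : seq (letter A)) (l : L) : M :=
  if w is x :: w' then Dl x l + dl x *: der_word w' (dl (linv x) *: l) else 0.

Lemma der_word_linear w : base_linear cg (der_word w).
Proof.
elim: w => [|x w IHw]; first by split=> *; rewrite /= ?addr0 ?scaler0.
have cl := conj_base_linear (fg_letter x) IHw; rewrite fg_letterV in cl.
split=> [l l' _ _|c l hc _] /=.
  by rewrite (base_linearD (Dl_linear x)) (base_linearD cl) addrACA.
by rewrite (base_linearZ (Dl_linear x)) // (base_linearZ cl) // scalerDr.
Qed.

(** [dl (linv x) * dl x] lies in C, so it passes through the C-linear [der_word w] and is absorbed
    by [dl x]. *)
Lemma der_word_genVK x w l :
  dl x *: der_word w (dl (linv x) *: (dl x *: l)) = dl x *: der_word w l.
Proof.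
rewrite scalerA (base_linearZ (der_word_linear w)); last first.
  by rewrite -fg_letterV; exact: base_genV_gen.
by rewrite scalerA mulrA letterK.
Qed.

(** If [x] cancels the first letter of [w], the two letter terms on the right cancel by [DlV];
    otherwise this is the recursion. *)
Lemma der_word_push x w l : der_word (fg_push x w) (dl x *: l) =
  Dl x (dl x *: l) + dl x *: der_word w l.
Proof.
case: w => [|y w] /=; first by rewrite !scaler0.
case: eqP => [->|_] /=; last first.
  by rewrite -[_ + _ *: der_word w _]/(der_word (y :: w) _) der_word_genVK.
rewrite scalerDr DlV linvK scalerA addrA subrr add0r.
have hb : homog cg 1%g (dl x * dl (linv x)).
  by rewrite -fg_letterV; exact: base_gen_genV.
rewrite -(base_linearZ (der_word_linear w)) // scalerA.
by rewrite letterK.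
Qed.

(** The Leibniz rule for a product of words in which letters may cancel, by pushing the letters of
    [w] one at a time. *)
Lemma der_word_mul w v l : der_word (word_mul w v) (gen_word w *: l) =
  der_word w (gen_word w *: l) + gen_word w *: der_word v l.
Proof.
elim: w => [|x w IHw] /=; first by rewrite !scale1r add0r.
rewrite -!scalerA der_word_push IHw der_word_genVK.
by rewrite scalerDr addrA.
Qed.

(** A homogeneous [r] of degree [g] is c d_g with c in C. Since D is to vanish on C, D(r) l = c
    D(d_g) l, which by C-linearity is [der_word] at [r *: l]. *)
Definition der_of_letters (r : R) (l : L) : M :=
  \sum_(g \in [set: free_group A]) der_word (fg_word g) (hcomp cg g r *: l).

Lemma der_of_letters_finsupp r l : finitely_supported
  (fun g => der_word (fg_word g) (hcomp cg g r *: l)).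
Proof.
have [s hs] := hcomp_finsupp cg r; exists s => g /hs ->.
by rewrite scale0r (base_linear0 (der_word_linear _)).
Qed.

Lemma der_of_letters_homog g r l : homog cg g r ->
  der_of_letters r l = der_word (fg_word g) (r *: l).
Proof.
move=> hr; rewrite /der_of_letters (@finsum_eq1 _ _ _ g) ?hr // => h hg.
rewrite (hcomp_homog h hr) (negbTE hg) scale0r.
exact: (base_linear0 (der_word_linear _)).
Qed.

Lemma der_of_lettersDl r s l :
  der_of_letters (r + s) l = der_of_letters r l + der_of_letters s l.
Proof.
rewrite /der_of_letters -finsumD; try exact: der_of_letters_finsupp.
apply: finsum_eq => g.
by rewrite hcompD scalerDl (base_linearD (der_word_linear _)).
Qed.

Lemma der_of_lettersDr r l l' :
  der_of_letters r (l + l') = der_of_letters r l + der_of_letters r l'.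
Proof.
rewrite /der_of_letters -finsumD; try exact: der_of_letters_finsupp.
apply: finsum_eq => g.
by rewrite scalerDr (base_linearD (der_word_linear _)).
Qed.

Lemma der_of_letters0 l : der_of_letters 0 l = 0.
Proof. by apply: (addIr (der_of_letters 0 l)); rewrite -der_of_lettersDl !add0r. Qed.

Lemma derivation_of_letters : derivation der_of_letters.
Proof.
split; [exact: der_of_lettersDl|exact: der_of_lettersDr|].
move=> r s l; elim/(@homog_ind _ _ cg): r => [|r r' IH IH'|h r hr].
- by rewrite mul0r !der_of_letters0 scale0r addr0.
- by rewrite mulrDl !der_of_lettersDl IH IH' scalerDl addrACA.
elim/(@homog_ind _ _ cg): s => [|s s' IH IH'|k s hs].
- rewrite mulr0 scale0r !der_of_letters0 scaler0 addr0.
  by apply: (addIr (der_of_letters r 0)); rewrite -der_of_lettersDr !add0r.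
- rewrite mulrDr !der_of_lettersDl IH IH' scalerDl der_of_lettersDr scalerDr.
  by rewrite addrACA.
rewrite (der_of_letters_homog _ (homogM hr hs)) (der_of_letters_homog _ hr).
rewrite (der_of_letters_homog _ hs) -scalerA.
(* [r] is the product of this element of C and [gen cg h], so by C-linearity only the Leibniz rule
   [der_word_mul] for words remains. *)
have hc : homog cg 1%g (r * gen cg h^-1%g).
  by apply: (homogMV hr); exact: homog_gen.
have rE (V : lmodType R) (y : V) : r *: y = (r * gen cg h^-1%g) *: (gen cg h *: y).
  by rewrite scalerA homog_genVK.
rewrite !rE !(base_linearZ (der_word_linear _) _ hc) -scalerDr; congr (_ *: _).
by rewrite -[fg_word (h * k)%g]/(word_mul _ _) gen_wordE der_word_mul.
Qed.

(** Both sides obey the Leibniz rule and vanish on C, so agreement on letters spreads to words and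
    then, C-linearly, to homogeneous elements. *)
Lemma der_of_letters_lift (N : lmodType R) (p : {linear M -> N}) (b : R -> L -> N) :
  derivation b -> (forall c x, homog cg 1%g c -> b c x = 0) ->
  (forall x l, p (Dl x (dl x *: l)) = b (dl x) l) ->
  forall r l, p (der_of_letters r l) = b r l.
Proof.
move=> derb b0 pDl r l.
have pw w : p (der_word w (gen_word w *: l)) = b (gen_word w) l.
  elim: w => [|x w IHw] /=; first by rewrite linear0 b0 //; exact: base1.
  rewrite -!scalerA der_word_genVK linearD linearZ /= pDl IHw.
  by rewrite (derM derb).
elim/(@homog_ind _ _ cg): r => [|r s IH IH'|h r hr].
- by rewrite der_of_letters0 linear0 b0 //; exact: homog0.
- by rewrite der_of_lettersDl linearD IH IH' (derDl derb).
have hc : homog cg 1%g (r * gen cg h^-1%g).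
  by apply: (homogMV hr); exact: homog_gen.
rewrite (der_of_letters_homog _ hr) -(homog_genVK hr) -scalerA.
rewrite (base_linearZ (der_word_linear _) _ hc) linearZ /= (gen_wordE h) pw -gen_wordE.
by rewrite (derM derb) (b0 _ _ hc) add0r.
Qed.

End Words.

(** For each generator a, the C-linear map sending l to b(d_a) applied to d_{a^-1} l is lifted along
    [p]; the group being free, these lifts are chosen independently. *)
Lemma free_group_derivations_lift (L : lmodType R) :
  base_projective cg L -> derivations_lift cg L.
Proof.
move=> projL M N p b psurj derb b0.
have bc c x : homog cg 1%g c -> forall r, c *: b r x = b (c * r) x.
  by move=> hc r; rewrite (derM derb) (b0 _ _ hc) add0r.
have cb c x : homog cg 1%g c -> forall r, b r (c *: x) = b (r * c) x.
  by move=> hc r; rewrite (derM derb) (b0 _ _ hc) scaler0 addr0.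
have base_b g : base_linear cg (fun l => b (gen cg g) (gen cg g^-1%g *: l)).
  split=> [l l' _ _|c l hc _]; first by rewrite scalerDr (derDr derb).
  rewrite bc // scalerA (genV_base _ hc) -scalerA cb; last exact: conj_base.
  by rewrite gen_conj_base.
have /choice[h hh] a := projL _ _ p _ psurj (base_b (fg_letter (a, true))).
(* The value at an inverse letter is dictated by [DlV]. *)
pose Dl (x : letter A) l :=
  if x.2 then h x.1 l else - (dl x *: h x.1 (dl (linv x) *: l)).
have Dll x : base_linear cg (Dl x).
  case: x => a []; first by case: (hh a).
  have := conj_base_linear (fg_letter (a, false)) (proj1 (hh a)).
  rewrite fg_letterV => cl; split=> [l l' _ _|c l hc _]; rewrite /Dl /=.
    by rewrite (base_linearD cl) opprD.
  by rewrite (base_linearZ cl) // scalerN.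
have ha a c l : homog cg 1%g c -> h a (c *: l) = c *: h a l.
  by move=> hc; rewrite (base_linearZ (proj1 (hh a))).
have hb x : homog cg 1%g (dl x * dl (linv x)).
  by rewrite -fg_letterV; exact: base_gen_genV.
have DlV x l : dl x *: Dl (linv x) l = - Dl x (dl x *: l).
  case: x => a [] /=; rewrite /Dl /= ?opprK.
    rewrite scalerN scalerA -ha //; congr (- h a _).
    by rewrite scalerA (letterVK (a, false)).
  rewrite (scalerA (dl (a, true))) (ha _ _ _ (hb (a, true))) scalerA mulrA.
  by rewrite (letterVK (a, true)).
exists (der_of_letters Dl); first exact: derivation_of_letters.
apply: der_of_letters_lift => // -[a []] l; rewrite /Dl /=.
  rewrite (proj2 (hh a)) fg_letterV scalerA cb; last first.
    by rewrite -fg_letterV; exact: base_genV_gen.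
  by rewrite mulrA (letterVK (a, false)).
rewrite linearN linearZ /= (proj2 (hh a)) fg_letterV.
rewrite [X in b _ X]scalerA scalerA -!mulrA (mulrA (dl _)) (letterVK (a, true)).
(* [b] vanishes on d_{a^-1} d_a, and the Leibniz rule for this product expresses [b] at the inverse
   letter through [b] at the letter. *)
have := b0 _ (dl (a, false) *: l) (hb (a, false)).
rewrite (derM derb) => /eqP; rewrite addr_eq0 => /eqP <-.
rewrite scalerA cb; last by have := hb (a, true).
by rewrite mulrA (letterVK (a, true)).
Qed.

End FreeGroupDerivation.

(** * Resolutions of length two *)

Section Resolution.
Variables (R : pzRingType) (M P0 P1 P2 : lmodType R).
Variables (e : {linear P0 -> M}) (d0 : {linear P1 -> P0}) (d1 : {linear P2 -> P1}).

(** Continues the resolution above degree 2, as resolutions are indexed by all naturals. *)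
Let zero_module : lmodType R := kernel_module (idfun : {linear R^o -> R^o}).

Lemma zero_module_eq0 (x : zero_module) : x = 0.
Proof. by apply: val_inj; exact: (kernel_valE x). Qed.

Lemma zero_module_projective : projective zero_module.
Proof.
move=> N N' p f _; exists (\0 : {linear zero_module -> N}) => x.
by rewrite [x]zero_module_eq0 !linear0.
Qed.

Let term (i : nat) : lmodType R :=
  match i with 0 => P0 | 1 => P1 | 2 => P2 | _ => zero_module end%N.

Let diff (i : nat) : {linear term i.+1 -> term i} :=
  match i with
  | 0 => d0 | 1 => d1
  | j.+2 => \0 : {linear zero_module -> term j.+2}
  end%N.

Lemma projective_dimension_le2 : projective P0 -> projective P1 -> projective P2 ->
  (forall y, exists x, e x = y) ->
  (forall x, e x = 0 <-> exists y, d0 y = x) ->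
  (forall x, d0 x = 0 <-> exists y, d1 y = x) ->
  (forall x, d1 x = 0 -> x = 0) -> projective_dimension_le M 2.
Proof.
move=> p0 p1 p2 esurj ex0 ex1 inj1.
have pterm i : projective (term i).
  by case: i => [|[|[|i]]] //; exact: zero_module_projective.
have exterm i (x : term i.+1) : diff i x = 0 <-> exists y, diff i.+1 y = x.
  case: i x => [|[|i]] x /=; first exact: ex1.
  - split=> [/inj1 ->|[y <-]]; last exact: linear0.
    by exists 0.
  - split=> // _; exists 0.
    by rewrite [RHS]zero_module_eq0.
exists (@ProjectiveResolution _ M term diff e pterm esurj ex0 exterm).
by case=> [|[|[|i]]] //= _ x; exact: zero_module_eq0.
Qed.

End Resolution.

(** * The bound on the global dimension *)

Section GlobalDimension.
Variables (R : pzRingType) (G : groupType) (cg : crossed_grading R G).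

(** R is the direct sum of the C_g d_g, and right multiplication by d_{g^-1} embeds each of them
    C-linearly into C, since d_g undoes it. This gives coordinates indexed by pairs [(i, g)]. *)
Lemma free_submodule_base_projective (I : choiceType) (L : lmodType R)
    (f : {linear L -> free_module R I}) :
  injective f -> base_projective cg L.
Proof.
move=> finj.
pose coord (ig : I * G) x := hcomp cg ig.2 (f x ig.1) * gen cg ig.2^-1%g.
apply: (@coord_base_projective _ _ cg L _ coord).
- move=> [i g] x; apply: (@homogMV _ _ cg g); first exact: homog_comp.
  exact: homog_gen.
- move=> [i g] x y; by rewrite /coord linearD free_funD hcompD mulrDl.
- move=> [i g] c x hc; by rewrite /coord linearZ free_funZ hcomp_baseM // mulrA.
- move=> x; have [r hr] := free_finsupp (f x).
  have [s hs] := choice (fun i => hcomp_finsupp cg (f x i)).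
  exists [seq (i, g) | i <- r, g <- s i] => -[i g] nig; rewrite /coord /=.
  have [ir|/hr ->] := boolP (i \in r); last by rewrite hcomp0 mul0r.
  rewrite hs ?mul0r //; apply: contra nig => gs.
  by apply/allpairsPdep; exists i, g.
- move=> x hx; apply: finj; rewrite linear0; apply/val_inj/funext => i /=.
  rewrite -[LHS](hcomp_sum cg); apply: finsum_eq0 => g.
  have e : hcomp cg g (f x i) * gen cg g^-1%g = 0 := hx (i, g).
  by rewrite -hcomp_genVK e mul0r.
Qed.

Lemma kernel_val_inj (L M : lmodType R) (f : {linear L -> M}) :
  injective (@kernel_val _ _ _ f).
Proof. exact: val_inj. Qed.

Lemma free_cover (M : lmodType R) :
  exists e : {linear free_module R M -> M}, forall y, exists x, e x = y.
Proof.
have [e eE] := linear_ofP (free_lift_linear (id : M -> M)).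
by exists e => y; exists (free_basis R y); rewrite eE free_lift_basis.
Qed.

Lemma global_dimension_le2 :
  (forall L : lmodType R, base_projective cg L -> derivations_lift cg L) ->
  global_dimension_le R 2.
Proof.
move=> lift M; have [e esurj] := free_cover M.
have [q qsurj] := free_cover (kernel_module e).
have pK : base_projective cg (kernel_module e).
  exact: free_submodule_base_projective (@kernel_val_inj _ _ e).
apply: (@projective_dimension_le2 _ _ _ _ _ e (@kernel_val _ _ _ e \o q)
  (@kernel_val _ _ _ q)) => //.
- exact: free_module_projective.
- exact: free_module_projective.
- by apply: (kernel_projective pK (lift _ pK)) => //; exact: free_module_projective.
- move=> x; split=> [ex|[y <-]]; last exact: kernel_valE.
  have kx : x \in ker_pred e by apply/eqP.
  by have [y yx] := qsurj (KernelModule kx); exists y; rewrite /= yx.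
- move=> x; split=> [/= qx|[y <-]] /=; last by rewrite kernel_valE linear0.
  have kx : x \in ker_pred q.
    by apply/eqP/kernel_val_inj; rewrite qx linear0.
  by exists (KernelModule kx).
- by move=> x x0; apply: kernel_val_inj; rewrite x0 linear0.
Qed.

End GlobalDimension.

(** * Transport of the grading along a ring isomorphism *)

Section Transport.
Variables (R S : pzRingType) (G : groupType).
Variables (phi : {rmorphism R -> S}) (psi : S -> R).
Hypotheses (phiK : cancel phi psi) (psiK : cancel psi phi).

(** The grading is constructed on the partial skew group ring, while the dimension bound is stated
    for the groupoid algebra. *)
Lemma crossed_grading_transport (cg : crossed_grading R G) :
  {cg' : crossed_grading S G | forall g, gen cg' g = phi (gen cg g)}.
Proof.
have psiD : {morph psi : x y / x + y}.
  by move=> x y; apply: (can_inj phiK); rewrite rmorphD !psiK.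
pose hc g s := phi (hcomp cg g (psi s)).
have hcK g r : hc g (phi r) = phi (hcomp cg g r) by rewrite /hc phiK.
have onto (P : S -> Prop) : (forall r, P (phi r)) -> forall s, P s.
  by move=> h s; rewrite -[s]psiK.
unshelve eexists (@CrossedGrading S G hc (phi \o gen cg) _ _ _ _ _ _ _ _ _ _) => //.
- by move=> g x y; rewrite /hc psiD hcompD rmorphD.
- elim/onto => r; have [s hs] := hcomp_finsupp cg r.
  by exists s => g /hs e; rewrite hcK e rmorph0.
- elim/onto => r; rewrite -[RHS](congr1 phi (hcomp_sum cg r)).
  rewrite (finsum_morph (rmorph0 phi) (rmorphD phi) (hcomp_finsupp cg r)).
  by apply: finsum_eq => g; exact: hcK.
- move=> g h; elim/onto => r; rewrite !hcK hcomp_comp.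
  by case: ifP => // _; rewrite rmorph0.
- move=> g h; elim/onto => r; elim/onto => s.
  by rewrite !hcK -rmorphM hcK hcompM.
- by move=> g; rewrite /= hcK hcomp_gen.
- by rewrite /= gen1 rmorph1.
- by elim/onto => r; elim/onto => s; rewrite !hcK -!rmorphM hcomp1C.
- by move=> g; elim/onto => r; rewrite /= !hcK -!rmorphM hcomp_genVK.
- have [v [vi vs]] := supports cg; exists (phi \o v); split.
    by move=> n; have [e1 e2] := vi n; rewrite /= hcK e1 -rmorphM e2.
  elim/onto => c; rewrite hcK => /(can_inj phiK)/vs[n [c' [e1 e2 e3]]].
  by exists n, (phi c'); rewrite hcK e1 -!rmorphM /= e2 -e2 e3.
Qed.

End Transport.

(** * Clopen subsets of a second countable compact space *)

(** A clopen set is compact and open, hence a finite union of basic open sets, and such unions are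
    coded by lists of naturals. *)
Lemma countable_clopen (X : topologicalType) :
  @second_countable X -> compact [set: X] ->
  exists U : nat -> set X, (forall n, clopen (U n)) /\
    forall V, clopen V -> exists n, U n = V.
Proof.
move=> [B /countable_injP[f finj] [Bo Bb]] cX.
pose W (s : seq nat) : set X := \bigcup_(b in [set b | B b /\ f b \in s]) b.
have onto V : clopen V -> exists s, W s = V.
  move=> [oV cV].
  have : compact V by rewrite -[V]setTI; exact: compact_closedI.
  (* Compactness yields one bound on the codes of the basic sets needed to cover [V]. *)
  rewrite compact_near_coveringP => /(_ nat \oo
    (fun n x => exists b, [/\ B b, (f b <= n)%N, b x & b `<=` V])) [].
    move=> x Vx; have [b [Bb' bx] bV] := Bb x V (open_nbhs_nbhs (conj oV Vx)).
    exists (b, [set n | f b <= n]%N) => /=.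
      split; first exact: open_nbhs_nbhs (conj (Bo _ Bb') bx).
      by exists (f b).
    by move=> [y n] [/= by_ fn]; exists b.
  move=> N _ hN; have /= {}hN := hN N (leqnn N).
  exists [seq n <- iota 0 N.+1 | `[< exists b, [/\ B b, f b = n & b `<=` V] >]].
  apply/seteqP; split=> [x [b [Bb' fbs] bx]|x Vx].
    move: fbs; rewrite mem_filter => /andP[/asboolP[b' [Bb'' fb bV]] _].
    by apply: bV; rewrite (finj b' b) // inE.
  have [b [Bb' fb bx bV]] := hN x Vx; exists b => //; split=> //.
  by rewrite mem_filter mem_iota leq0n add0n ltnS fb !andbT; apply/asboolP; exists b.
pose w n := W (odflt [::] (unpickle n)).
(* Indices whose union is not clopen are sent to the empty set. *)
exists (fun n => if `[< clopen (w n) >] then w n else set0); split=> [n|V cV].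
  by case: asboolP => // _; exact: clopen0.
have [s sV] := onto V cV; exists (pickle s); rewrite /w pickleK /= sV.
by case: asboolP.
Qed.

(** * The grading of the partial skew group ring *)

Section SkewGrading.
Variables (K : fieldType) (G : groupType) (X : topologicalType).
Variables (theta : partial_action G X) (cX : compact [set: X]).
Local Notation psr := (partial_skew_ring K theta cX).
Local Notation delta := (@skew_delta K G X).

Lemma lc_indicator (U : set X) : clopen U ->
  locally_constant (fun x => (x \in U)%:R : K).
Proof.
move=> [oU cU] x; have [Ux|nUx] := pselect (U x).
  by near=> z; rewrite !mem_set //; near: z; exact: open_nbhs_nbhs.
have oC : open (~` U) by exact: closed_openC.
near=> z; rewrite !memNset //; near: z.
exact: (open_nbhs_nbhs (conj oC nUx)).
Unshelve. all: by end_near. Qed.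

Lemma delta_mem g (f : X -> K^o) : locally_constant f ->
  (forall x, ~ pdom theta g x -> f x = 0) -> delta g f \in skew_pred K theta.
Proof.
move=> lf zf; apply: (@skew_predI _ _ _ _ _ [:: g]) => [h|h|h x].
- by rewrite inE /skew_delta => /negbTE ->.
- by rewrite /skew_delta; case: eqP => _; [exact: lc_lcc | exact: rpred0].
- by rewrite /skew_delta; case: eqP => [->|//]; exact: zf.
Qed.

Lemma skew_fun_lc (F : psr) g : locally_constant (F g : X -> K).
Proof. by case/skewP: (skew_mem F) => _ /(_ g)/lccP[]. Qed.

Lemma skew_funN (F : psr) g x : ~ pdom theta g x -> (F : G -> X -> K^o) g x = 0.
Proof. by case/skewP: (skew_mem F) => _ _; exact. Qed.

Definition skew_comp g (F : psr) : psr :=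
  Skew (delta_mem (skew_fun_lc F g) (@skew_funN F g)).

Definition dom_indicator g : X -> K^o := fun x => (x \in pdom theta g)%:R.

Lemma dom_indicatorN g x : ~ pdom theta g x -> dom_indicator g x = 0.
Proof. by move=> nx; rewrite /dom_indicator memNset. Qed.

Definition skew_gen g : psr :=
  Skew (delta_mem (lc_indicator (pdom_clopen theta g)) (@dom_indicatorN g)).

(** On X_g, where [f] lives, the outer [alpha g] undoes the inner [alpha g^-1] and moves only the
    argument of [f']. *)
Lemma skew_mul_deltaE g h (f f' : X -> K^o) :
  (forall x, ~ pdom theta g x -> f x = 0) ->
  skew_mul theta (delta g f) (delta h f') =
  delta (g * h)%g (fun x => f x * f' (pact theta g^-1%g x)).
Proof.
move=> zf; rewrite skew_mul_delta; congr (delta _ _); apply/funext => x.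
have [dx|dx] := pselect (pdom theta g x); last by rewrite alphaN // zf // mul0r.
rewrite alphaT // /GRing.mul /= alphaT; last exact: pact_domV.
by rewrite invgK pactVV.
Qed.

Lemma delta_delta g h f : delta g (delta h f g) = if g == h then delta h f else 0.
Proof.
apply/funext => k; rewrite /skew_delta; case: (eqVneq g h) => [->|] //.
by case: ifP.
Qed.

Lemma skew_comp_delta g h (F : psr) f : skew_fun F = delta h f ->
  skew_comp g F = if g == h then F else 0.
Proof.
move=> Ff; apply: skew_inj; rewrite /= Ff delta_delta.
by case: ifP => _; rewrite ?Ff.
Qed.

Lemma skew_compD g : {morph skew_comp g : F F' / F + F'}.
Proof.
move=> F F'; apply: skew_inj; apply/funext => h; rewrite /=.
by rewrite -[RHS]/(delta g (F g) h + delta g (F' g) h) /skew_delta;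
  case: ifP; rewrite ?addr0.
Qed.

Lemma skew_comp_finsupp F : finitely_supported (skew_comp ^~ F).
Proof.
have [r _ hr] := skew_supp (skew_mem F); exists r => g /hr Fg.
by apply: skew_inj; apply/funext => h; rewrite /= /skew_delta Fg; case: ifP.
Qed.

Lemma skew_comp_sum F : \sum_(g \in [set: G]) skew_comp g F = F.
Proof.
apply: skew_inj; apply/funext => k; apply/funext => x.
rewrite (@finsum_morph _ _ K (fun H : psr => skew_fun H k x)) //.
  rewrite (@finsum_eq1 _ _ _ k) => [|g gk] /=; first by rewrite /skew_delta eqxx.
  by rewrite /skew_delta eq_sym (negbTE gk).
exact: skew_comp_finsupp.
Qed.

Lemma skew_delta1 (f : X -> K^o) : locally_constant f ->
  exists F : psr, skew_fun F = delta 1%g f.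
Proof.
move=> lf; have z x : ~ pdom theta 1%g x -> f x = 0 by rewrite pdom1 => /(_ I).
by exists (Skew (delta_mem lf z)).
Qed.

Lemma skew_mul_delta1 (f f' : X -> K^o) :
  skew_mul theta (delta 1%g f) (delta 1%g f') = delta 1%g (fun x => f x * f' x).
Proof.
rewrite skew_mul_deltaE ?mulg1 ?invg1; last by rewrite pdom1 => x /(_ I).
by congr (delta _ _); apply/funext => x; rewrite pact1.
Qed.

Hypothesis countX : @second_countable X.

(** The support of [c] is clopen, hence one of countably many sets, and [c] times its pointwise
    inverse is the indicator of that set. *)
Lemma skew_supports : exists v : nat -> psr,
  (forall n, skew_comp 1%g (v n) = v n /\ v n * v n = v n) /\
  forall c, skew_comp 1%g c = c -> exists n c',
    [/\ skew_comp 1%g c' = c', v n = c' * c & c * v n = c].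
Proof.
have [U [cU Uonto]] := countable_clopen countX cX.
have [v vE] := choice (fun n => skew_delta1 (lc_indicator (cU n))).
exists v; split=> [n|c hc].
  split; first by rewrite (skew_comp_delta _ (vE n)) eqxx.
  apply: skew_inj; rewrite psr_mulE vE skew_mul_delta1; congr (delta _ _).
  by apply/funext => x; rewrite -natrM mulnb andbb.
have cE : skew_fun c = delta 1%g (c 1%g) by rewrite -{1}hc.
have lc := @skew_fun_lc c 1%g.
have [n nE] : exists n, U n = [set x | c 1%g x != 0].
  apply: Uonto; split; last exact: (locally_constant_closed (P := fun a => a != 0)).
  rewrite openE => x /= cx; rewrite /interior.
  by apply: filterS (lc x) => z /= ->.
(* The inverse of 0 is 0, so the pointwise inverse is a total function vanishing off the support of
   [c]. *)
have lci : locally_constant (fun x => (c 1%g x)^-1 : K).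
  exact: (locally_constant2 (fun a _ => a^-1) lc lc).
have [c' c'E] := skew_delta1 lci.
exists n, c'; split; first by rewrite (skew_comp_delta _ c'E) eqxx.
- apply: skew_inj; rewrite psr_mulE vE c'E [X in skew_mul _ _ X]cE skew_mul_delta1 nE.
  congr (delta _ _); apply/funext => x.
  have [cx|cx] := eqVneq (c 1%g x) 0.
    by rewrite cx mulr0 memNset //= cx eqxx.
  by rewrite mem_set //; exact: (esym (@mulVf K _ cx)).
- apply: skew_inj; rewrite psr_mulE vE {1}cE skew_mul_delta1 nE [RHS]cE.
  congr (delta _ _); apply/funext => x.
  have [cx|cx] := eqVneq (c 1%g x) 0; first by rewrite cx mul0r.
  by rewrite mem_set // mulr1.
Qed.

Lemma skew_gen1 : skew_gen 1%g = 1.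
Proof.
apply: skew_inj; apply/funext => g /=; rewrite /skew_delta /skew_one.
case: eqP => // _; apply/funext => x.
by rewrite /dom_indicator mem_set // pdom1.
Qed.

Lemma skew_compM g h (F F' : psr) :
  skew_comp (g * h)%g (skew_comp g F * skew_comp h F') = skew_comp g F * skew_comp h F'.
Proof.
have e := skew_mul_deltaE h (F' h) (@skew_funN F g).
by rewrite (@skew_comp_delta _ _ (skew_comp g F * skew_comp h F') _ e) eqxx.
Qed.

Lemma skew_comp1C (F F' : psr) :
  skew_comp 1%g F * skew_comp 1%g F' = skew_comp 1%g F' * skew_comp 1%g F.
Proof.
apply: skew_inj; rewrite !psr_mulE !skew_mul_delta1.
by congr (delta _ _); apply/funext => x; rewrite mulrC.
Qed.

(** As theta_{g^-1} maps X_g into X_{g^-1}, multiplying f delta_g by the generator of g^-1 gives f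
    in degree one, and the generator of g restores it. *)
Lemma skew_comp_genVK g (F : psr) :
  skew_comp g F * skew_gen g^-1%g * skew_gen g = skew_comp g F.
Proof.
apply: skew_inj; rewrite !psr_mulE /= skew_mul_deltaE; last exact: skew_funN.
rewrite mulgV skew_mul_deltaE ?mul1g; last by rewrite pdom1 => x /(_ I).
congr (delta _ _); apply/funext => x; rewrite invg1 pact1.
have [dx|dx] := pselect (pdom theta g x); last by rewrite skew_funN // !mul0r.
by rewrite /dom_indicator !mem_set ?mulr1 //; exact: pact_domV.
Qed.

Definition skew_grading : crossed_grading psr G.
Proof.
refine (@CrossedGrading psr G skew_comp skew_gen skew_compD skew_comp_finsupp
  skew_comp_sum _ skew_compM _ skew_gen1 skew_comp1C skew_comp_genVK skew_supports).
- by move=> g h F; exact: (@skew_comp_delta g h _ (F h)).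
- by move=> g; rewrite (@skew_comp_delta g g _ (dom_indicator g)) ?eqxx.
(* Transparent, so that [gen] of this grading reduces to [skew_gen]. *)
Defined.

End SkewGrading.

(** * Semi-saturation and the isomorphism of the two algebras *)

Lemma fg_lengthV (A : choiceType) (u : free_group A) :
  fg_length u^-1%g = fg_length u.
Proof. by rewrite /fg_length /= size_rev size_map. Qed.

(* Semi-saturation, read for inverses: X_{uv} consists of the x in X_u with
   theta_{u^-1} x in X_v. *)
Lemma skew_gen_reduced (K : fieldType) (A : choiceType) (X : topologicalType)
    (theta : partial_action (free_group A) X) (cX : compact [set: X])
    (u v : free_group A) : semi_saturated theta ->
  fg_length (u * v)%g = (fg_length u + fg_length v)%N ->
  skew_gen K theta cX (u * v)%g = skew_gen K theta cX u * skew_gen K theta cX v.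
Proof.
move=> sat uv; have [|e _] := sat v^-1%g u^-1%g.
  by rewrite -invgM !fg_lengthV uv addnC.
rewrite -invgM !invgK in e.
apply: skew_inj; rewrite psr_mulE /= skew_mul_deltaE; last exact: dom_indicatorN.
congr (skew_delta _ _); apply/funext => x.
rewrite /dom_indicator -natrM mulnb; congr (_%:R); congr nat_of_bool.
apply/idP/andP; rewrite e.
  by move=> /set_mem[ux vx]; rewrite !mem_set.
by move=> [/set_mem ux /set_mem vx]; rewrite mem_set.
Qed.

Section GroupoidSkewIso.
Variables (K : fieldType) (G : groupType) (X : topologicalType).
Variables (theta : partial_action G X) (cX : compact [set: X]).
Local Notation ga := (groupoid_algebra K theta cX).
Local Notation psr := (partial_skew_ring K theta cX).

Lemma ga_of_psr_rmorphism : exists phi : {rmorphism psr -> ga},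
  phi =1 @ga_of_psr K G X theta cX.
Proof.
pose f : psr -> ga := @ga_of_psr K G X theta cX.
have fB : zmod_morphism f.
  by move=> F F'; apply: (addIr (f F')); rewrite subrK -ga_of_psrD subrK.
have fM : monoid_morphism f by split; [exact: ga_of_psr1 | exact: ga_of_psrM].
pose m1 := GRing.isZmodMorphism.Build psr ga f fB.
pose m2 := GRing.isMonoidMorphism.Build psr ga f fM.
by exists (HB.pack_for {rmorphism psr -> ga} f m1 m2).
Qed.

Lemma psr_of_ga_rmorphism : exists phi : {rmorphism ga -> psr},
  phi =1 @psr_of_ga K G X theta cX.
Proof.
have inj := can_inj (@ga_of_psrK K G X theta cX).
pose f : ga -> psr := @psr_of_ga K G X theta cX.
have fK : cancel f (@ga_of_psr K G X theta cX) := @psr_of_gaK K G X theta cX.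
have fB : zmod_morphism f.
  move=> F F'; apply: (addIr (f F')); apply: inj.
  by rewrite subrK ga_of_psrD !fK subrK.
have fM : monoid_morphism f.
  by split=> [|F F']; apply: inj; rewrite ?ga_of_psrM ?ga_of_psr1 !fK.
pose m1 := GRing.isZmodMorphism.Build ga psr f fB.
pose m2 := GRing.isMonoidMorphism.Build ga psr f fM.
by exists (HB.pack_for {rmorphism ga -> psr} f m1 m2).
Qed.

End GroupoidSkewIso.

Theorem theoremC (A : choiceType) (X : topologicalType)
    (theta : partial_action (free_group A) X)
    (countX : @second_countable X)
    (compX : compact [set: X])
    (hausX : hausdorff_space X)
    (discX : totally_disconnected [set: X])
    (satX : semi_saturated theta)
    (K : fieldType) :
  (exists phi : {rmorphism groupoid_algebra K theta compX ->
                           partial_skew_ring K theta compX},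
      bijective phi /\ scalable phi) /\
  global_dimension_le (groupoid_algebra K theta compX) 2.
Proof.
have [phi phiE] := ga_of_psr_rmorphism K theta compX.
have [psi psiE] := psr_of_ga_rmorphism K theta compX.
have phiK : cancel phi psi by move=> F; rewrite phiE psiE ga_of_psrK.
have psiK : cancel psi phi by move=> f; rewrite phiE psiE psr_of_gaK.
split.
  exists psi; split; first by exists phi.
  (* [phi] is injective and scalable, hence so is its inverse. *)
  by move=> a f; apply: (can_inj phiK); rewrite psiK !phiE ga_of_psrZ -phiE psiK.
(* The transported generators remain multiplicative along products without cancellation, by
   semi-saturation. *)
have [cg cgE] := crossed_grading_transport phiK psiK (skew_grading K theta compX countX).
apply: (@global_dimension_le2 _ _ cg) => L pL.
apply: free_group_derivations_lift pL => u v uv.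
by rewrite !cgE -rmorphM /= skew_gen_reduced.
Qed.
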